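(* Let $\lambda=(\lambda_1,\lambda_2,\dots,\lambda_r)$ be a partition. Then the $1$-Young complex $\Delta_1^\lambda$ is vertex-decomposable. Moreover, for every integer $t\ge2$, the following are equivalent: (1) $\Delta_t^\lambda$ is vertex-decomposable; (2) $\Delta_t^\lambda$ is shellable; (3) $\Delta_t^\lambda$ is Cohen--Macaulay (over a field $K$); (4) either $r=1$, or $r\ge2$ and $\lambda_2\le t$.
   Context: A partition $\lambda=(\lambda_1,\dots,\lambda_r)$ is a finite sequence of integers $\lambda_1\ge\lambda_2\ge\dots\ge\lambda_r\ge1$ ($r\ge1$), identified with its Young diagram: a top- and left-justified array of boxes with $\lambda_j$ boxes in row $j$, row $1$ being the top row. For a positive integer $t$, fill the box in row $j$ and column $i$ ($1\le j\le r$, $1\le i\le\lambda_j$) with the integer $(r-j)t+i$. The $t$-Young complex $\Delta_t^\lambda$ is the $(\lambda_1-1)$-dimensional pure simplicial complex whose facets are all sets $\{a_1,\dots,a_{\lambda_1}\}$ with $a_1<\dots<a_{\lambda_1}$ and such that $a_j$ is an entry of the $j$-th column of $\lambda$ for every $1\le j\le\lambda_1$. For a vertex $v$ of a simplicial complex $\Delta$, $\mathrm{lk}_\Delta(v)=\{\sigma\in\Delta: v\notin\sigma,\ \sigma\cup\{v\}\in\Delta\}$ and $\mathrm{del}_\Delta(v)=\{\sigma\in\Delta: v\notin\sigma\}$. A vertex $x$ is a shedding vertex if every facet of $\mathrm{del}_\Delta(x)$ is a facet of $\Delta$. $\Delta$ is vertex-decomposable if $\Delta=\{\emptyset\}$,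 or $\Delta$ is a simplex (has exactly one facet), or there is a shedding vertex $x$ of $\Delta$ such that $\mathrm{lk}_\Delta(x)$ and $\mathrm{del}_\Delta(x)$ are both vertex-decomposable. A pure simplicial complex is shellable if its facets can be ordered $F_1,\dots,F_m$ so that for each $2\le i\le m$ the complex $\langle F_1,\dots,F_{i-1}\rangle\cap\langle F_i\rangle$ is generated by a non-empty set of maximal proper faces of $F_i$. $\Delta$ is Cohen--Macaulay over $K$ if $\widetilde H_i(\mathrm{lk}_\Delta(\sigma);K)=0$ for every face $\sigma\in\Delta$ and every $i<\dim \mathrm{lk}_\Delta(\sigma)$, where $\mathrm{lk}_\Delta(\sigma)=\{\tau\in\Delta:\tau\cap\sigma=\emptyset,\ \tau\cup\sigma\in\Delta\}$. *)

(* Defs.v *)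
From HB Require Import structures.
From mathcomp Require Import all_boot all_order all_algebra.

Set Implicit Arguments.
Unset Strict Implicit.
Unset Printing Implicit Defensive.

Import Order.TTheory GRing.Theory Num.Theory.

(* Simplicial complexes are sets of faces [D : {set {set T}}] on a finite     *)
(* ground set [T]; elements of [T] need not be vertices: [x] is a vertex of   *)
(* [D] when [[set x] \in D].                                                  *)

Section Complexes.

Variable T : finType.
Implicit Types (A D : {set {set T}}) (s u F : {set T}) (x : T).

Definition simplicial_complex D : Prop :=
  set0 \in D /\ (forall s u, s \in D -> u \subset s -> u \in D).

Definition generated A : {set {set T}} := [set s : {set T} | [exists F in A, s \subset F]].

Definition facets D : {set {set T}} := [set s : {set T} | maxset (fun u => u \in D) s].

(* As an integer, so that the complex [[set set0]] has dimension -1. *)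
Definition dim D : int := ((\max_(s in D) #|s|)%:Z - 1)%R.

Definition pure D : Prop :=
  forall s u, s \in facets D -> u \in facets D -> #|s| = #|u|.

Definition vertex_link D x : {set {set T}} :=
  [set s in D | (x \notin s) && (x |: s \in D)].

Definition deletion D x : {set {set T}} := [set s in D | x \notin s].

Definition link D s : {set {set T}} :=
  [set u in D | [disjoint u & s] && (u :|: s \in D)].

Definition shedding_vertex D x : Prop :=
  [set x] \in D /\ facets (deletion D x) \subset facets D.

Inductive vertex_decomposable D : Prop :=
| VD_empty of D = [set set0]
| VD_simplex of #|facets D| = 1
| VD_shedding x of shedding_vertex D x &
    vertex_decomposable (vertex_link D x) &
    vertex_decomposable (deletion D x).

Definition maximal_proper_face F s : bool := maxset (fun u => u \proper F) s.

Definition shelling (Fs : seq {set T}) : Prop :=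
  forall i, 0 < i < size Fs ->
  let F := nth set0 Fs i in
  exists G : {set {set T}},
    [/\ G != set0,
        {in G, forall s, maximal_proper_face F s} &
        generated [set s in take i Fs] :&: generated [set F] = generated G].

Definition shellable D : Prop :=
  pure D /\ exists Fs : seq {set T}, [/\ uniq Fs, Fs =i facets D & shelling Fs].

Lemma generated_complex A : A != set0 -> simplicial_complex (generated A).
Proof.
case/set0Pn=> F FA; split.
  by rewrite inE; apply/existsP; exists F; rewrite FA sub0set.
move=> s u; rewrite !inE => /existsP[G /andP[GA sG]] us.
by apply/existsP; exists G; rewrite GA (subset_trans us).
Qed.

Lemma link_complex D s :
  simplicial_complex D -> s \in D -> simplicial_complex (link D s).
Proof.
move=> [D0 Dsub] sD; split; first by rewrite inE D0 set0U sD disjoints_subset sub0set.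
move=> u v; rewrite !inE => /and3P[uD us usD] vu.
by rewrite (Dsub _ _ uD vu) (disjointWl vu us) (Dsub _ _ usD) // setSU.
Qed.

Lemma deletion_complex D x :
  simplicial_complex D -> simplicial_complex (deletion D x).
Proof.
move=> [D0 Dsub]; split; first by rewrite !inE D0.
move=> s u; rewrite !inE => /andP[sD xs] us.
by rewrite (Dsub _ _ sD us); apply: contra xs; apply: subsetP.
Qed.

Lemma vertex_linkE D x : vertex_link D x = link D [set x].
Proof.
by apply/setP=> s; rewrite !inE disjoint_sym disjoints1 setUC.
Qed.

End Complexes.

Section Homology.

Local Open Scope ring_scope.

Variables (K : fieldType) (n : nat).
Implicit Types (D : {set {set 'I_n}}) (s : {set 'I_n}) (i : int).

Definition chain : vectType K := {ffun {set 'I_n} -> K^o}.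

Definition face_chain s : chain := [ffun u => (u == s)%:R].

Definition face_boundary s : chain :=
  \sum_(x in s) (-1) ^+ #|[set y in s | (y < x)%N]| *: face_chain (s :\ x).

Definition boundary_fun (c : chain) : chain := \sum_s c s *: face_boundary s.

Fact boundary_fun_is_linear : linear boundary_fun.
Proof.
move=> a c d; rewrite /boundary_fun scaler_sumr -big_split /=.
by apply: eq_bigr => s _; rewrite !ffunE scalerDl scalerA.
Qed.

HB.instance Definition _ :=
  GRing.isLinear.Build K chain chain _ boundary_fun boundary_fun_is_linear.

Definition boundary : 'End(chain) := linfun boundary_fun.

(* The empty face spans the chains of degree -1, as befits reduced homology.  *)
Definition chains D i : {vspace chain} :=
  (\sum_(s in D | #|s|%:Z == (i + 1)%R) <[face_chain s]>)%VS.

Definition cycles D i : {vspace chain} := (chains D i :&: lker boundary)%VS.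

Definition boundaries D i : {vspace chain} := (boundary @: chains D (i + 1)%R)%VS.

(* The quotient cycles / boundaries is modelled by a complement of the        *)
(* boundaries in the cycles, see [boundaries_sub_cycles].                     *)
Definition reduced_homology D i : {vspace chain} :=
  (cycles D i :\: boundaries D i)%VS.

Definition cohen_macaulay D : Prop :=
  forall s, s \in D ->
  forall i, i < dim (link D s) -> reduced_homology (link D s) i = 0%VS.

Lemma boundary_face s : boundary (face_chain s) = face_boundary s.
Proof.
rewrite lfunE /= /boundary_fun (bigD1 s) //= big1 ?addr0 => [|u us].
  by rewrite ffunE eqxx scale1r.
by rewrite ffunE (negPf us) scale0r.
Qed.

Lemma boundary_boundary_face s : boundary (face_boundary s) = 0.
Proof.
pose e s' (x : 'I_n) : K := (-1) ^+ #|[set y in s' | (y < x)%N]|.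
pose f x y := e s x *: (e (s :\ x) y *: face_chain (s :\ x :\ y)).
have fC (x y : 'I_n) : x \in s -> y \in s -> (x < y)%N -> f y x = - f x y.
  move=> xs ys xy; rewrite /f !scalerA -scaleNr; congr (_ *: _); last first.
    by congr face_chain; apply/setP=> z; rewrite !inE andbCA.
  have -> : e (s :\ y) x = e s x.
    rewrite /e; congr (_ ^+ _); apply: eq_card => z; rewrite !inE.
    by case: eqP => //= ->; rewrite ltnNge (ltnW xy) /= andbF.
  suff -> : e s y = - e (s :\ x) y by rewrite mulNr mulrC.
  rewrite /e (cardsD1 x) !inE xs xy add1n exprS mulN1r; congr (- _ ^+ _).
  by apply: eq_card => z; rewrite !inE andbA.
have -> : boundary (face_boundary s) =
    \sum_(x in s) \sum_(y in s | y != x) f x y.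
  rewrite linear_sum; apply: eq_bigr => x xs.
  rewrite linearZ /= boundary_face scaler_sumr; apply: eq_big => [y|y _] //.
  by rewrite !inE andbC.
have split_lt x : \sum_(y in s | y != x) f x y =
    \sum_(y in s | (x < y)%N) f x y + \sum_(y in s | (y < x)%N) f x y.
  rewrite (bigID (fun y : 'I_n => (x < y)%N)) /=.
  by congr (_ + _); apply: eq_bigl => y; rewrite -andbA; congr (_ && _);
     rewrite -val_eqE /=; case: ltngtP.
rewrite (eq_bigr _ (fun x _ => split_lt x)) big_split /=.
rewrite [X in _ + X](exchange_big_dep (mem s)) //=; last by move=> x y _ /andP[].
rewrite -big_split big1 //= => x xs.
suff -> : \sum_(y in s | (x \in s) && (x < y)%N) f y x =
          - \sum_(y in s | (x < y)%N) f x y by rewrite addrN.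
rewrite -sumrN; apply: eq_big => [y|y]; first by rewrite xs.
by rewrite xs => /andP[ys xy]; rewrite fC.
Qed.

Lemma boundaries_sub_cycles D i :
  simplicial_complex D -> (boundaries D i <= cycles D i)%VS.
Proof.
move=> [_ Dsub]; rewrite /boundaries limg_sum; apply/subv_sumP=> s /andP[sD si].
rewrite limg_line -memvE boundary_face memv_cap memv_ker boundary_boundary_face.
rewrite eqxx andbT; apply: memv_suml => x xs; apply: memvZ.
have xD : s :\ x \in D by apply: Dsub sD (subsetDl _ _).
rewrite memvE /chains (bigD1 (s :\ x)) ?addvSl //= xD /=.
by rewrite -(inj_eq (addIr 1)) -(eqP si) (cardsD1 x s) xs add1n -addn1 PoszD.
Qed.

End Homology.

Definition is_partition (la : seq nat) : bool :=
  [&& 0 < size la, sorted geq la & all (leq 1) la].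

(* Rows and columns are numbered from 1. *)
Definition part (la : seq nat) (j : nat) : nat := nth 0 la j.-1.

Definition young_entry (la : seq nat) (t j i : nat) : nat :=
  (size la - j) * t + i.

Definition young_column (la : seq nat) (t i : nat) : seq nat :=
  [seq young_entry la t j i | j <- iota 1 (size la) & i <= part la j].

Definition young_max (la : seq nat) (t : nat) : nat :=
  (size la).-1 * t + part la 1.

(* The ground set is {0, ..., young_max la t}, which contains every entry by  *)
(* [young_column_le]; 0 is never a vertex.                                    *)
Definition young_facets (la : seq nat) (t : nat) :
    {set {set 'I_(young_max la t).+1}} :=
  [set A | [exists a : (part la 1).-tuple 'I_(young_max la t).+1,
    [&& sorted ltn [seq val x | x <- a],
        [forall j : 'I_(part la 1), val (tnth a j) \in young_column la t j.+1] &
        A == [set x in a]]]].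

Definition young_complex (la : seq nat) (t : nat) :
    {set {set 'I_(young_max la t).+1}} :=
  generated (young_facets la t).

Lemma young_column_le la t i a :
  i <= part la 1 -> a \in young_column la t i ->
  a <= young_max la t.
Proof.
move=> i1 /mapP[j]; rewrite mem_filter mem_iota => /and3P[_ j1 _] ->.
by rewrite leq_add // leq_mul2r -subn1 leq_sub2l ?orbT.
Qed.

Lemma card_young_facet la t A : A \in young_facets la t -> #|A| = part la 1.
Proof.
rewrite inE => /existsP[a /and3P[sa _ /eqP->]].
rewrite cardsE -[RHS](size_tuple a); apply/card_uniqP.
by rewrite -(map_inj_uniq val_inj) (sorted_uniq ltn_trans ltnn).
Qed.

Lemma facets_young_complex la t :
  facets (young_complex la t) = young_facets la t.
Proof.
apply/setP=> A; rewrite inE; apply/idP/idP.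
  case/maxsetP; rewrite inE => /existsP[F /andP[FY AF]] maxA.
  by rewrite -(maxA F) // inE; apply/existsP; exists F; rewrite FY /=.
move=> AY; have AD : A \in young_complex la t.
  by rewrite inE; apply/existsP; exists A; rewrite AY /=.
apply/maxsetP; split=> // B; rewrite inE => /existsP[F /andP[FY BF]] AB.
apply/eqP; rewrite eq_sym eqEcard AB (card_young_facet AY) -(card_young_facet FY).
exact: subset_leq_card.
Qed.

Lemma young_complex_complex la t :
  is_partition la -> simplicial_complex (young_complex la t).
Proof.
case/and3P=> la0 _ _; apply: generated_complex; apply/set0Pn.
have lt_top (j : 'I_(part la 1)) : (size la).-1 * t + j.+1 < (young_max la t).+1.
  by rewrite ltnS leq_add2l.
pose a := [tuple Ordinal (lt_top j) | j < part la 1].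
exists [set x in a]; rewrite inE; apply/existsP; exists a; apply/and3P; split=> //.
  rewrite -map_comp.
  rewrite (_ : [seq _ | _ <- _] =
    [seq (size la).-1 * t + k.+1 | k <- [seq val j | j <- enum 'I_(part la 1)]]).
    rewrite val_enum_ord sorted_map (@sub_sorted _ ltn) ?iota_ltn_sorted //.
    by move=> x y; rewrite /= ltn_add2l ltnS.
  by rewrite -map_comp.
apply/forallP=> j; rewrite tnth_mktuple /=; apply/mapP; exists 1.
  by rewrite mem_filter ltn_ord mem_iota /= add1n ltnS.
by rewrite /young_entry subn1.
Qed.

(* Main.v *)
From HB Require Import structures.
Require Import Defs.
From mathcomp Require Import all_boot all_order all_algebra zify ring.

(* Counting rows from the bottom and columns from the left, both from [0], a
   facet picks in each column [i] a row [f i], where [f] is nondecreasing and lies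
   between the height [l i] of the lowest box of column [i] and the top row.
   Families of such [f] with bounds [l <= f <= u] are closed under links and
   deletions of a well chosen vertex in the last column [i] with [l i < u i]:
   - for [t = 1], where entries are constant along diagonals, the top entry of
     column [i]: a facet containing it can be pushed down by one along the
     diagonal run ending there;
   - for [t >= 2] and [la_2 <= t], where no entry occurs in two columns, the
     bottom entry of column [i], which can be replaced by the entry above it.
   If [la_2 > t >= 2], the entry [(r - 1) t + 1] lies in the top row of column [0]
   and in the second row of column [t].  In the link of this entry together with
   the top entries of the columns beyond [t], the facets consist either of larger
   entries only or of smaller entries only.  So this link is disconnected of
   positive dimension, which contradicts both shellability and the
   Cohen-Macaulay property. *)

Set Implicit Arguments.
Unset Strict Implicit.
Unset Printing Implicit Defensive.

Import Order.TTheory GRing.Theory Num.Theory.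

(** * Facets and shellings *)

Section Facets.
Variable T : finType.
Implicit Types (A D : {set {set T}}) (s u F : {set T}) (x : T).

Lemma facetP D F :
  reflect (F \in D /\ forall G, G \in D -> F \subset G -> G = F)
          (F \in facets D).
Proof. by rewrite inE; apply: (iffP maxsetP). Qed.

Lemma facet_face D F : F \in facets D -> F \in D.
Proof. by case/facetP. Qed.

Lemma face_sub_facet D s : s \in D -> exists2 F, F \in facets D & s \subset F.
Proof.
move=> sD; have [F FD sF] := @maxset_exists _ (fun u => u \in D) s sD.
by exists F; rewrite ?inE.
Qed.

Lemma mem_deletion D x s : (s \in deletion D x) = (s \in D) && (x \notin s).
Proof. by rewrite inE. Qed.

Lemma mem_vertex_link D x s :
  (s \in vertex_link D x) = [&& s \in D, x \notin s & x |: s \in D].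
Proof. by rewrite inE. Qed.

Lemma mem_generated A s :
  reflect (exists2 F, F \in A & s \subset F) (s \in generated A).
Proof. by rewrite inE; apply: exists_inP. Qed.

Lemma sub_generated A F : F \in A -> F \in generated A.
Proof. by move=> FA; apply/mem_generated; exists F. Qed.

Lemma facets_generated A m :
  {in A, forall F, #|F| = m} -> facets (generated A) = A.
Proof.
move=> cardA; apply/setP=> F; apply/facetP/idP => [[/mem_generated[G GA FG] maxF]|FA].
  by rewrite -(maxF G) ?sub_generated.
split=> [|G /mem_generated[H HA GH] FG]; first exact: sub_generated.
apply/eqP; rewrite eq_sym eqEcard FG (cardA F) // -(cardA H) //.
exact: subset_leq_card.
Qed.

Lemma generated1_vd F : vertex_decomposable (generated [set F]).
Proof.
apply: VD_simplex; rewrite (@facets_generated _ #|F|) ?cards1 //.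
by move=> G /set1P->.
Qed.

(** By the exchange hypothesis the members of [A] avoiding [x] generate the whole deletion; having
    the common cardinality [m], they are facets of both complexes, so [x] is shedding. The members
    through [x], with [x] removed, generate the link. *)
Lemma vd_generated_step A m x :
    {in A, forall F, #|F| = m} ->
    (exists2 F, F \in A & x \in F) ->
    {in A, forall F, x \in F -> exists2 G, G \in A & (x \notin G) && (F :\ x \subset G)} ->
    vertex_decomposable (generated [set F in A | x \notin F]) ->
    vertex_decomposable (generated [set F :\ x | F in A & x \in F]) ->
  vertex_decomposable (generated A).
Proof.
move=> cardA [F0 F0A xF0] exA vd_del vd_link.
have delE : deletion (generated A) x = generated [set F in A | x \notin F].
  apply/setP=> s; rewrite mem_deletion; apply/andP/mem_generated => [[/mem_generated[F FA sF] xs]|].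
    have [xF|xF] := boolP (x \in F); last by exists F; rewrite // inE FA.
    have [G GA /andP[xG FG]] := exA F FA xF.
    by exists G; [rewrite inE GA | apply: subset_trans FG; rewrite subsetD1 sF].
  case=> F /setIdP[FA xF] sF; split; last exact: contra (subsetP sF x) xF.
  by apply/mem_generated; exists F.
have linkE : vertex_link (generated A) x = generated [set F :\ x | F in A & x \in F].
  apply/setP=> s; rewrite mem_vertex_link; apply/and3P/mem_generated.
    case=> _ xs /mem_generated[F FA]; rewrite subUset sub1set => /andP[xF sF].
    by exists (F :\ x); [apply/imsetP; exists F; rewrite ?inE ?FA | rewrite subsetD1 sF].
  case=> _ /imsetP[F /setIdP[FA xF] ->]; rewrite subsetD1 => /andP[sF xs].
  split=> //; apply/mem_generated; exists F => //.
  by rewrite subUset sub1set xF.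
apply: (@VD_shedding _ _ x); rewrite ?delE ?linkE //.
split; first by apply/mem_generated; exists F0; rewrite ?sub1set.
rewrite delE (facets_generated cardA) (@facets_generated _ m).
  by apply/subsetP=> F /[!inE] /andP[].
by move=> F /[!inE] /andP[FA _]; apply: cardA.
Qed.

Lemma facet_vertex_link D x F : simplicial_complex D ->
  (F \in facets (vertex_link D x)) = (x \notin F) && (x |: F \in facets D).
Proof.
case=> _ subD; apply/facetP/andP => [[]|[xF /facetP[xFD maxF]]].
  rewrite inE => /and3P[FD xF xFD] maxF; split=> //; apply/facetP; split=> // G GD.
  rewrite subUset sub1set => /andP[xG FG].
  rewrite -(setD1K xG); congr (_ |: _); apply: maxF; last by rewrite subsetD1 FG.
  by rewrite !inE eqxx setD1K // GD andbT (subD G) // subsetDl.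
split=> [|G]; first by rewrite inE xF xFD (subD _ _ xFD) // subsetUr.
rewrite inE => /and3P[GD xG xGD] FG.
by rewrite -(setU1K xG) (maxF (x |: G)) ?setU1K // setUS.
Qed.

Lemma facet_deletion D x F : shedding_vertex D x ->
  (F \in facets (deletion D x)) = (x \notin F) && (F \in facets D).
Proof.
case=> _ subF; apply/idP/andP => [Fdel|[xF /facetP[FD maxF]]].
  split; last exact: (subsetP subF).
  by move/facet_face: Fdel; rewrite inE => /andP[].
apply/facetP; split=> [|G]; first by rewrite inE FD.
by rewrite inE => /andP[GD _]; apply: maxF.
Qed.

Lemma vertex_link_complex D x : simplicial_complex D -> [set x] \in D ->
  simplicial_complex (vertex_link D x).
Proof. by rewrite vertex_linkE; apply: link_complex. Qed.

Lemma mem_link D s u :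
  (u \in link D s) = [&& u \in D, [disjoint u & s] & u :|: s \in D].
Proof. by rewrite inE. Qed.

Lemma disjointsU1 x s u : [disjoint x |: s & u] = (x \notin u) && [disjoint s & u].
Proof. by rewrite !disjoints_subset subUset sub1set in_setC. Qed.

Lemma link_vertex_link D s x :
    (forall s u, s \in D -> u \subset s -> u \in D) -> x \in s ->
  link (vertex_link D x) (s :\ x) = link D s.
Proof.
move=> subD xs; apply/setP=> u; rewrite !mem_link !mem_vertex_link.
rewrite setUCA setD1K // in_setU setD11 orbF.
apply/idP/idP => [/and3P[/and3P[uD xu xuD] us /and3P[usD _ usxD]]|/and3P[uD us usD]].
  rewrite uD usxD -(setD1K xs) disjoint_sym disjointsU1 disjoint_sym.
  by rewrite xu us.
have xu : x \notin u by apply: contraTN xs => xu; rewrite (disjointFr us xu).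
rewrite uD xu usD (disjointWr _ us) ?subsetDl // (subD _ _ usD) /=; last first.
  by rewrite subUset sub1set in_setU xs orbT subsetUl.
by rewrite (subD _ _ usD) // setUS // subsetDl.
Qed.

Lemma vertex_link_link D s x : x \notin s ->
  vertex_link (link D s) x = link (vertex_link D x) s.
Proof.
move=> xs; apply/setP=> u; rewrite mem_vertex_link !mem_link !mem_vertex_link.
rewrite disjointsU1 in_setU negb_or xs setUA andbT.
by do 4!case: (_ \in D); case: (x \in u); case: [disjoint u & s].
Qed.

Lemma deletion_link D s x : x \notin s ->
  deletion (link D s) x = link (deletion D x) s.
Proof.
move=> xs; apply/setP=> u; rewrite mem_deletion !mem_link !mem_deletion.
rewrite in_setU negb_or xs andbT.
by do 2!case: (_ \in D); case: (x \in u); case: [disjoint u & s].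
Qed.

Lemma deletion_link_id D s x :
    (forall s u, s \in D -> u \subset s -> u \in D) -> x |: s \notin D ->
  deletion (link D s) x = link D s.
Proof.
move=> subD xsD; apply/setP=> u; rewrite mem_deletion andb_idr // mem_link.
case/and3P=> _ _ usD; apply: contra xsD => xu; apply: subD usD _.
by rewrite subUset sub1set in_setU xu subsetUr.
Qed.

Lemma vertex_link_card D x m : simplicial_complex D ->
  {in facets D, forall F, #|F| = m} ->
  {in facets (vertex_link D x), forall F, #|F| = m.-1}.
Proof.
move=> cD cardD F; rewrite facet_vertex_link // => /andP[xF /cardD <-].
by rewrite cardsU1 xF.
Qed.

Lemma deletion_card D x m : shedding_vertex D x ->
  {in facets D, forall F, #|F| = m} ->
  {in facets (deletion D x), forall F, #|F| = m}.
Proof. by move=> sx cardD F; rewrite facet_deletion // => /andP[_ /cardD]. Qed.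

(** * Shellings as exchange orders *)

Lemma maximal_proper_faceP F s :
  reflect (exists2 y, y \in F & s = F :\ y) (maximal_proper_face F s).
Proof.
apply: (iffP maxsetP) => [[/properP[sF [y yF ys]] maxs]|[y yF ->]].
  exists y => //; symmetry; apply: maxs; last by rewrite subsetD1 sF.
  by rewrite properD1.
split=> [|B BF FB]; first by rewrite properD1.
have /properP[BsF [z zF zB]] := BF.
apply/eqP; rewrite eqEsubset FB andbT subsetD1 BsF.
suff <- : z = y by [].
by apply/eqP; apply: contraNT zB => zy; apply: (subsetP FB); rewrite !inE zy.
Qed.

(** The facet-exchange form of a shelling: [G :&: F] lies in the ridge [F :\ y], itself contained in
    an earlier facet. Splitting the list instead of indexing it suits induction on its last
    element. *)
Definition exchange_order (Fs : seq {set T}) : Prop :=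
  forall Fs1 F Fs2, Fs = Fs1 ++ F :: Fs2 -> 
  forall G : {set T}, G \in Fs1 ->
  exists2 y, (y \in F) && (y \notin G) & exists2 H : {set T}, H \in Fs1 & F :\ y \subset H.

Lemma exchange_prefix Fs Gs : exchange_order (Fs ++ Gs) -> exchange_order Fs.
Proof. by move=> exFs Fs1 F Fs2 FsE; apply: (exFs _ _ (Fs2 ++ Gs)); rewrite FsE -catA. Qed.

Lemma exchange_rcons Fs F : exchange_order Fs ->
  (forall G : {set T}, G \in Fs -> exists2 y, (y \in F) && (y \notin G) &
     exists2 H : {set T}, H \in Fs & F :\ y \subset H) ->
  exchange_order (rcons Fs F).
Proof.
move=> exFs exF Fs1 G Fs2; case/lastP: Fs2 => [|Fs2 F'].
  by rewrite cats1 => /rcons_inj[<- <-].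
by rewrite -rcons_cons -rcons_cat => /rcons_inj[/exFs].
Qed.

Lemma cat_take_nth_drop (Fs : seq {set T}) i : i < size Fs ->
  Fs = take i Fs ++ nth set0 Fs i :: drop i.+1 Fs.
Proof. by move=> iFs; rewrite -drop_nth ?cat_take_drop. Qed.

(** The face [G :&: F] belongs to the intersection complex, hence lies in a generator [F :\ y]; this
    excludes [y] from [G], and the generator is a face of an earlier [H]. *)
Lemma shelling_exchange Fs : shelling Fs -> exchange_order Fs.
Proof.
move=> shFs Fs1 F Fs2 FsE G GFs1.
have szFs1 : 0 < size Fs1 < size Fs.
  by rewrite FsE size_cat /= addnS ltnS leq_addr andbT; case: (Fs1) GFs1.
have [A [_ maxA]] := shFs _ szFs1.
rewrite FsE nth_cat ltnn subnn take_size_cat //= in maxA * => /setP eqA.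
have : G :&: F \in generated A.
  rewrite -eqA inE; apply/andP; split; apply/mem_generated.
    by exists G; rewrite ?inE ?subsetIl.
  by exists F; rewrite ?inE ?subsetIr.
case/mem_generated=> s sA GFs.
have /maximal_proper_faceP[y yF sE] := maxA _ sA; exists y.
  by rewrite yF; apply: contraTN GFs => yG; apply/subsetPn; exists y; rewrite ?sE !inE ?yG ?eqxx.
have := sub_generated sA; rewrite -eqA inE => /andP[/mem_generated[H]].
by rewrite inE sE => HFs sH _; exists H.
Qed.

Lemma exchange_shelling Fs : exchange_order Fs -> shelling Fs.
Proof.
move=> exFs i /andP[i0 iFs] F; have FsE := cat_take_nth_drop iFs.
(* The generators are the ridges of [F] that lie in an earlier facet. *)
pose A := [set s | maximal_proper_face F s && has (fun H : {set T} => s \subset H) (take i Fs)].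
have exA (G : {set T}) : G \in take i Fs -> exists2 s, s \in A & G :&: F \subset s.
  move=> GFs; have [y /andP[yF yG] [H HFs FH]] := exFs _ _ _ FsE _ GFs.
  exists (F :\ y); last by rewrite subsetD1 subsetIr !inE (negPf yG).
  rewrite inE; apply/andP; split; first by apply/maximal_proper_faceP; exists y.
  by apply/hasP; exists H.
exists A; split.
- have [s sA _] : exists2 s, s \in A & nth set0 Fs 0 :&: F \subset s.
    by apply: exA; rewrite -(nth_take _ i0) mem_nth // size_takel // ltnW.
  by apply/set0Pn; exists s.
- by move=> s /[!inE] /andP[].
apply/setP=> s; rewrite in_setI; apply/andP/mem_generated.
  case=> /mem_generated[G GFs sG] /mem_generated[_ /set1P-> sF].
  rewrite inE in GFs.
  have [u uA GFu] := exA _ GFs.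
  by exists u => //; apply: subset_trans GFu; rewrite subsetI sG.
case=> u /setIdP[/maximal_proper_faceP[y yF uE] /hasP[H HFs uH]] su.
split; apply/mem_generated; first by exists H; rewrite ?inE // (subset_trans su).
by exists F; rewrite ?inE // (subset_trans su) // uE subsetDl.
Qed.

(** Facets of the deletion of the shedding vertex [x] come first, then the facets through [x] in the
    order of the link. Against a facet of the deletion the exchanged vertex is [x]; against another
    facet through [x] it is given by the link. *)
Lemma vd_exchange_order D : vertex_decomposable D -> simplicial_complex D ->
  exists Fs : seq {set T}, [/\ uniq Fs, Fs =i facets D & exchange_order Fs].
Proof.
have single F : exchange_order [:: F].
  by move=> [|G [|? ?]] ? ? //= [].
elim=> {D}[D ->|D cardF|D x sx _ IHl _ IHd] cD.
- exists [:: set0]; split=> // F; rewrite inE.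
  apply/eqP/facetP => [->|[/set1P //]].
  by split=> [|G /set1P //]; rewrite inE.
- have /cards1P[F FE] : #|facets D| == 1 by rewrite cardF.
  by exists [:: F]; split=> // G; rewrite FE !inE.
have [xD _] := sx.
have [Fl [ul Fl_mem exl]] := IHl (vertex_link_complex cD xD).
have [Fd [ud Fd_mem exd]] := IHd (deletion_complex x cD).
have xFl F : F \in Fl -> x \notin F.
  by rewrite Fl_mem facet_vertex_link // => /andP[].
exists (Fd ++ [seq x |: F | F <- Fl]); split.
- rewrite cat_uniq ud map_inj_in_uniq ?ul ?andbT //=.
    apply/hasPn=> _ /mapP[F _ ->]; rewrite /= Fd_mem facet_deletion //.
    by rewrite !inE eqxx.
  by move=> F G /xFl xF /xFl xG FG; rewrite -(setU1K xF) FG setU1K.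
- move=> F; rewrite mem_cat Fd_mem facet_deletion //.
  have [xF|xF] /= := boolP (x \in F).
    apply/mapP/idP => [[G GFl ->]|FD].
      by move: GFl; rewrite Fl_mem facet_vertex_link // => /andP[].
    exists (F :\ x); last by rewrite setD1K.
    by rewrite Fl_mem facet_vertex_link // setD11 setD1K.
  apply: orb_idr => /mapP[G _ FE].
  by move: xF; rewrite FE !inE eqxx.
have Fl_del F : F \in Fl -> exists2 H : {set T}, H \in Fd & F \subset H.
  rewrite Fl_mem => /facet_face; rewrite mem_vertex_link => /and3P[FD xF _].
  have [H HD FH] : exists2 H : {set T}, H \in facets (deletion D x) & F \subset H.
    by apply: face_sub_facet; rewrite inE FD.
  by exists H; rewrite ?Fd_mem.
have xFd F : F \in Fd -> x \notin F.
  by rewrite Fd_mem facet_deletion // => /andP[].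
(* The induction runs over prefixes of [Fl], so [Fl_mem], which they do not inherit, is dropped
   first. *)
elim/last_ind: Fl exl xFl Fl_del {ul Fl_mem} => [|Fl F IH] exl xFl Fl_del; first by rewrite cats0.
rewrite map_rcons -rcons_cat; apply: exchange_rcons.
  apply: IH => [|G GFl|G GFl]; last 2 first.
  - by apply: xFl; rewrite mem_rcons inE GFl orbT.
  - by apply: Fl_del; rewrite mem_rcons inE GFl orbT.
  by move: exl; rewrite -cats1; apply: exchange_prefix.
have xF : x \notin F by apply: xFl; rewrite mem_rcons mem_head.
move=> G; rewrite mem_cat => /orP[GFd|/mapP[G1 GFl ->]].
  exists x; first by rewrite !inE eqxx xFd.
  have [|H HFd FH] := Fl_del F; first by rewrite mem_rcons mem_head.
  by exists H; rewrite ?mem_cat ?HFd // setU1K.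
have [|y /andP[yF yG] [H HFl FH]] := exl Fl F [::] _ G1 GFl; first by rewrite cats1.
have yx : y != x by apply: contraNneq xF => <-.
exists y; first by rewrite !inE yF (negPf yx) (negPf yG) orbT.
exists (x |: H); first by rewrite mem_cat map_f ?orbT.
apply/subsetP=> z /[!inE] /andP[zy /orP[->//|zF]].
by rewrite (subsetP FH) ?orbT // !inE zy.
Qed.

(** The vertex [z] exchanged between [F] and an earlier [G] is outside [s], so the earlier [H] above
    [F :\ z] still contains [s]. As [F :\: s] has a second element, [F] and [H] share a vertex
    outside [s], and [F] inherits the colour of [H], which is that of [G] by induction. *)
Lemma exchange_order_link_connected (p : pred T) s Fs : exchange_order Fs ->
    (forall F : {set T}, F \in Fs -> s \subset F ->
       1 < #|F :\: s| /\ {in F :\: s &, forall x y, p x = p y}) ->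
  forall F G : {set T}, F \in Fs -> G \in Fs -> s \subset F -> s \subset G ->
  forall x y, x \in F :\: s -> y \in G :\: s -> p x = p y.
Proof.
elim/last_ind: Fs => [|Fs F IH] // exFs conn.
have {}IH : forall G H : {set T}, G \in Fs -> H \in Fs -> s \subset G -> s \subset H ->
    forall x y, x \in G :\: s -> y \in H :\: s -> p x = p y.
  apply: IH; first by move: exFs; rewrite -cats1; apply: exchange_prefix.
  by move=> G GFs; apply: conn; rewrite mem_rcons inE GFs orbT.
have key (G : {set T}) x y : G \in Fs -> s \subset F -> s \subset G ->
    x \in F :\: s -> y \in G :\: s -> p x = p y.
  move=> GFs sF sG xF yG.
  have [|z /andP[zF zG] [H HFs FH]] := exFs Fs F [::] _ G GFs; first by rewrite cats1.
  have zs : z \notin s by apply: contra zG; apply: subsetP.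
  have [|card_F connF] := conn F _ sF; first by rewrite mem_rcons mem_head.
  have zFs : z \in F :\: s by rewrite inE zs.
  have /card_gt0P[w] : 0 < #|(F :\: s) :\ z|.
    by move: card_F; rewrite (cardsD1 z) zFs.
  rewrite in_setD1 => /andP[wz wF].
  rewrite (connF x w) //; apply: (IH H G) yG => //.
    by apply: subset_trans FH; rewrite subsetD1 sF.
  move: wF; rewrite !inE => /andP[-> wF] /=.
  by apply: (subsetP FH); rewrite !inE wz.
move=> G H; rewrite !mem_rcons !inE => /predU1P[->|GFs] /predU1P[->|HFs] sG sH x y xG yH.
- by have [|_] := conn F _ sG; [rewrite mem_rcons mem_head | apply].
- exact: key HFs _ _ _ _.
- by symmetry; apply: key GFs _ _ _ _.
- exact: IH xG yH.
Qed.

End Facets.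

(** * Reduced homology *)

Section Acyclic.
Local Open Scope ring_scope.
Variables (K : fieldType) (n : nat).
Implicit Types (D E : {set {set 'I_n}}) (s u : {set 'I_n}) (i k : int) (x y : 'I_n).
Local Notation chain := (chain K n).
Local Notation boundary := (boundary K n).
Implicit Types c e : chain.

Lemma chainP c e : (forall u : {set 'I_n}, c u = e u) -> c = e.
Proof. by move=> ce; apply/ffunP. Qed.

(** The incidence sign of [x]. Its value is the same whether or not [u] contains [x], so it serves
    both for removing [x] and for adding it. *)
Definition face_sign x u : K := (-1) ^+ #|[set y in u | (y < x)%N]|.

Lemma face_signK x u : face_sign x u * face_sign x u = 1.
Proof. by rewrite -expr2 sqrr_sign. Qed.

Lemma face_sign_add x y u : x != y -> y \notin u ->
  face_sign x (y |: u) = (-1) ^+ (y < x)%N * face_sign x u.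
Proof.
move=> xy yu; rewrite /face_sign -exprD; congr (_ ^+ _).
have [yx|yx] := ltnP y x.
  rewrite (cardsD1 y) !inE eqxx yx; congr (_ + _)%N; apply: eq_card => z.
  by rewrite !inE; case: eqVneq => // ->; rewrite (negPf yu).
apply: eq_card => z; rewrite !inE; case: eqVneq => //= ->.
by rewrite ltnNge yx (negPf yu).
Qed.

Lemma face_signU1 x u : face_sign x (x |: u) = face_sign x u.
Proof.
congr (_ ^+ _); apply: eq_card => z; rewrite !inE.
by case: eqVneq => // ->; rewrite ltnn !andbF.
Qed.

Lemma face_signD1 x u : x \in u -> face_sign x (u :\ x) = face_sign x u.
Proof. by move=> xu; rewrite -[in RHS](setD1K xu) face_signU1. Qed.

(** Exactly one of [x < y] and [y < x] holds, so exactly one of the two signs changes. *)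
Lemma face_sign_swap x y u : x != y -> x \notin u -> y \notin u ->
  face_sign x (y |: u) * face_sign y (x |: u) = - (face_sign x u * face_sign y u).
Proof.
move=> xy xu yu; rewrite !face_sign_add 1?[y == x]eq_sym //.
by case: ltngtP (xy) => [_ _|_ _|/val_inj->]; rewrite ?eqxx // expr0 expr1; ring.
Qed.

Lemma chain_sum c : c = \sum_s c s *: face_chain K s.
Proof.
apply: chainP => u; rewrite sum_ffunE (bigD1 u) //= big1 => [|s su].
  by rewrite !ffunE eqxx addr0 [RHS]mulr1.
by rewrite !ffunE eq_sym (negPf su) [LHS]mulr0.
Qed.

Lemma boundaryE c u :
  boundary c u = \sum_(y | y \notin u) face_sign y u * c (y |: u).
Proof.
rewrite lfunE /= /boundary_fun sum_ffunE.
transitivity (\sum_(s : {set 'I_n}) \sum_(y in s) c s * face_sign y s * (u == s :\ y)%:R).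
  apply: eq_bigr => s _; rewrite ffunE /face_boundary sum_ffunE [LHS]mulr_sumr.
  by apply: eq_bigr => y ys; rewrite !ffunE -mulrA.
rewrite (exchange_big_dep predT) //= [RHS]big_mkcond; apply: eq_bigr => y _.
have [yu|yu] /= := boolP (y \in u).
  rewrite big1 // => s ys; case: eqVneq => [uE|]; last by rewrite mulr0.
  by move: yu; rewrite uE setD11.
rewrite (bigD1 (y |: u)) ?setU11 //= setU1K // eqxx mulr1 face_signU1 mulrC.
rewrite big1 ?addr0 // => s /andP[ys su]; case: eqVneq => [uE|]; last by rewrite mulr0.
by move: su; rewrite uE setD1K ?eqxx.
Qed.

Lemma mem_chainsP D i c :
  reflect (forall s, c s != 0 -> s \in D /\ #|s|%:Z = i + 1) (c \in chains K D i).
Proof.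
apply: (iffP idP) => [/memv_sumP[v v_face ->] s|cD].
  rewrite sum_ffunE => vs; suff /andP[-> /eqP->] : (s \in D) && (#|s|%:Z == i + 1) by [].
  apply: contraNT vs => sD; rewrite big1 // => u uD.
  have /vlineP[a ->] := v_face u uD.
  by rewrite !ffunE; case: eqVneq => [su|_]; [rewrite su uD in sD | rewrite [LHS]mulr0].
rewrite [c]chain_sum; apply: memv_suml => s _.
have [->|cs] := eqVneq (c s) 0; first by rewrite scale0r mem0v.
have [sD si] := cD s cs; apply/memvZ; rewrite memvE.
by apply: (sumv_sup s); rewrite // sD si eqxx.
Qed.

(** * Cones, contractions and acyclicity *)

Lemma boundary_boundary c : boundary (boundary c) = 0.
Proof.
rewrite [c]chain_sum !linear_sum big1 // => s _.
by rewrite !linearZ /= boundary_face boundary_boundary_face scaler0.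
Qed.

(** Join with [x], given by coefficients: up to sign, a face without [x] is sent to its union with
    [x], and a face containing [x] to zero. *)
Definition cone x c : chain :=
  [ffun u : {set 'I_n} => if x \in u then face_sign x u * c (u :\ x) else 0].

(** The part of [c] through [x], with [x] stripped off: the connecting map of Mayer-Vietoris, with
    values in chains of the link. *)
Definition contraction x c : chain :=
  [ffun u : {set 'I_n} => if x \in u then 0 else face_sign x u * c (x |: u)].

(** The cone is a contracting homotopy. At [u] without [x] only the term adding [x] survives; at [u]
    containing [x] that term cancels [c u], and the others match by [face_sign_swap]. *)
Lemma boundary_cone x c : boundary (cone x c) = c - cone x (boundary c).
Proof.
apply: chainP => u; rewrite !ffunE !boundaryE.
have [xu|xu] := boolP (x \in u); last first.
  rewrite subr0 (bigD1 x) //= ffunE setU11 setU1K // face_signU1 mulrA face_signK mul1r.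
  rewrite big1 ?addr0 // => y /andP[yu yx].
  by rewrite ffunE !inE [x == y]eq_sym (negPf yx) (negPf xu) mulr0.
rewrite [in RHS](bigD1 x) ?setD11 //= setD1K // face_signD1 // mulrDr mulrA face_signK.
rewrite mul1r opprD addNKr mulr_sumr -sumrN.
apply: eq_big => [y|y yu]; first by rewrite !inE; case: eqVneq => [->|]; rewrite ?xu ?andbT.
have yx : y != x by apply: contraNneq yu => ->.
rewrite ffunE !inE xu orbT setDUl.
have -> : [set y] :\ x = [set y].
  by apply/setP=> z; rewrite !inE; case: (eqVneq z y) => [->|]; rewrite ?yx ?andbF.
suff swap : face_sign y u * face_sign x (y |: u) = - (face_sign x u * face_sign y (u :\ x)).
  by rewrite mulrA swap mulNr -mulrA.
rewrite -[in X in X * _](setD1K xu) -[in X in _ * X](setD1K xu) setUCA face_signU1.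
rewrite -(face_signD1 xu) mulrC face_sign_swap ?setD11 1?eq_sym //.
by rewrite !inE negb_and yu orbT.
Qed.

(** Adding [x] and [y] to a face in the two orders gives opposite signs. Hence the contraction of a
    cycle is a cycle. *)
Lemma boundary_contraction x c :
  boundary (contraction x c) = - contraction x (boundary c).
Proof.
apply: chainP => u; rewrite !ffunE !boundaryE.
have [xu|xu] := boolP (x \in u).
  by rewrite oppr0 big1 // => y yu; rewrite ffunE inE xu orbT mulr0.
rewrite (bigD1 x) //= ffunE setU11 mulr0 add0r mulr_sumr -sumrN.
apply: eq_big => [y|y /andP[yu yx]]; first by rewrite !inE negb_or andbC.
rewrite ffunE !inE [x == y]eq_sym (negPf yx) (negPf xu) /= setUCA !mulrA.
rewrite -mulNr; congr (_ * _).
rewrite !face_sign_add // 1?eq_sym //.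
case: ltngtP (yx) => [_ _|_ _|/val_inj->]; rewrite ?eqxx // expr0 expr1; ring.
Qed.

Lemma mem_cone_chains D E i x c :
    (forall s, s \in D -> x \notin s -> x |: s \in E) ->
  c \in chains K D i -> cone x c \in chains K E (i + 1).
Proof.
move=> DE /mem_chainsP cD; apply/mem_chainsP => s.
rewrite ffunE; case: ifP => [xs|_]; last by rewrite eqxx.
rewrite mulf_eq0 negb_or => /andP[_ /cD[sD cs]].
have := DE _ sD; rewrite setD11 setD1K // => -> //; split=> //.
by rewrite (cardsD1 x) xs -cs PoszD addrC.
Qed.

Lemma mem_contraction_chains D x i c :
  (forall s u, s \in D -> u \subset s -> u \in D) ->
  c \in chains K D i -> contraction x c \in chains K (vertex_link D x) (i - 1).
Proof.
move=> subD /mem_chainsP cD; apply/mem_chainsP => s.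
rewrite ffunE; case: ifPn => [_|xs]; first by rewrite eqxx.
rewrite mulf_eq0 negb_or mem_vertex_link xs => /andP[_ /cD[sD cs]].
rewrite (subD _ _ sD) ?subsetUr // sD; split=> //; apply: (addrI 1).
by rewrite subrK [RHS]addrC -cs cardsU1 xs.
Qed.

Lemma mem_sub_chains D E i c :
  D \subset E -> c \in chains K D i -> c \in chains K E i.
Proof.
by move=> /subsetP DE /mem_chainsP cD; apply/mem_chainsP => s /cD[/DE].
Qed.

(** Vanishing of reduced homology in degrees below [k]. The bound is a parameter so that it can drop
    by one on passing to the link of a vertex. *)
Definition acyclic_below D k : Prop := forall i, i < k ->
  (cycles K D i <= boundaries K D i)%VS.

Lemma acyclic_belowP D k :
  (forall i c, i < k -> c \in chains K D i -> boundary c = 0 ->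
     exists2 e, e \in chains K D (i + 1) & boundary e = c) -> acyclic_below D k.
Proof.
move=> acD i ik; apply/subvP=> c; rewrite memv_cap memv_ker => /andP[cD /eqP c0].
by have [e eD <-] := acD i c ik cD c0; apply: memv_img.
Qed.

Lemma acyclic_belowE D k i c : acyclic_below D k ->
  i < k -> c \in chains K D i -> boundary c = 0 ->
  exists2 e, e \in chains K D (i + 1) & boundary e = c.
Proof.
move=> acD ik cD c0; have /subvP/(_ c) := acD i ik.
rewrite memv_cap memv_ker cD c0 eqxx => /(_ isT)/memv_imgP[e eD ->].
by exists e.
Qed.

(** The empty face, of degree [-1], is the smallest, so there are no nonzero chains below it. *)
Lemma acyclic_below_negative D : acyclic_below D (- 1).
Proof.
apply: acyclic_belowP => i c i_lt /mem_chainsP cD _; exists 0; first exact: mem0v.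
rewrite linear0; apply: chainP => s; rewrite ffunE; symmetry; apply/eqP.
by apply/negPn/negP => /cD[_ cs]; lia.
Qed.

Lemma acyclic_cone D x k : (forall s, s \in D -> x |: s \in D) -> acyclic_below D k.
Proof.
move=> DD; apply: acyclic_belowP => i c _ cD c0.
exists (cone x c); first by apply: mem_cone_chains cD => s /DD.
rewrite boundary_cone c0; suff -> : cone x 0 = 0 by rewrite subr0.
by apply: chainP => u; rewrite !ffunE mulr0 if_same.
Qed.

(* Mayer-Vietoris for [D] as the union of the deletion of [x] and of the cone
   over the link of [x]. *)
Lemma acyclic_link_deletion D x k :
    (forall s u, s \in D -> u \subset s -> u \in D) ->
    acyclic_below (vertex_link D x) (k - 1) -> acyclic_below (deletion D x) k ->
  acyclic_below D k.
Proof.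
move=> subD acl acd; apply: acyclic_belowP => i c ik cD c0.
have ik1 : i - 1 < k - 1 by rewrite ltrD2r.
have dc0 : boundary (contraction x c) = 0.
  rewrite boundary_contraction c0; apply: chainP => u.
  by rewrite !ffunE mulr0 if_same oppr0.
have [e] := acyclic_belowE acl ik1 (mem_contraction_chains x subD cD) dc0.
rewrite subrK => el de.
have le : vertex_link D x \subset deletion D x.
  by apply/subsetP=> s; rewrite mem_vertex_link mem_deletion => /and3P[-> ->].
have ce : boundary (cone x e) = e - cone x (contraction x c) by rewrite boundary_cone de.
(* Here [cone x (contraction x c)] is the part of [c] on faces containing [x], so adding this
   boundary replaces that part by [e] and moves [c] into the deletion. *)
pose c' := c + boundary (cone x e).
have c'd : c' \in chains K (deletion D x) i.
  rewrite /c' ce addrCA memvD //; first exact: mem_sub_chains le el.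
  apply/mem_chainsP=> s; rewrite !ffunE mem_deletion; case: ifPn => xs.
    by rewrite setD11 setD1K // face_signD1 // mulrA face_signK mul1r subrr eqxx.
  by rewrite subr0 andbT; move/mem_chainsP: cD; apply.
have dc' : boundary c' = 0.
  by rewrite /c' linearD /= c0 add0r boundary_boundary.
have [e' e'd de'] := acyclic_belowE acd ik c'd dc'.
exists (e' - cone x e); last by rewrite linearB /= de' addrK.
rewrite memvB //; first by apply: mem_sub_chains e'd; apply/subsetP=> s; rewrite mem_deletion => /andP[].
apply: mem_cone_chains el => s; rewrite mem_vertex_link => /and3P[_ _ xsD] _.
exact: xsD.
Qed.

(** All links are treated together. In a simplex they are cones, or the empty complex at the facet.
    For a shedding vertex [x] in [s], the link of [s] is a link inside that of [x]. Otherwise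
    Mayer-Vietoris applies, or [x] misses the link of [s], which then is a link in the deletion. *)
Lemma vd_acyclic_link D m : vertex_decomposable D -> simplicial_complex D ->
    {in facets D, forall F : {set 'I_n}, #|F| = m} ->
  {in D, forall s, acyclic_below (link D s) (m%:Z - #|s|%:Z - 1)}.
Proof.
move=> vdD; elim: vdD m => {D}[D ->|D cardF|D x sx _ IHl _ IHd] m cD cardD s sD.
- rewrite -(cardD set0); last by apply/facetP; split=> [|G /set1P]; rewrite ?set11.
  by move/set1P: sD => ->; rewrite cards0; apply: acyclic_below_negative.
- have /cards1P[F FE] : #|facets D| == 1%N by rewrite cardF.
  have FD : F \in facets D by rewrite FE set11.
  have DE u : (u \in D) = (u \subset F).
    apply/idP/idP => [uD|uF]; last by case: cD => _ subD; apply: subD uF; apply: facet_face.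
    by have [G] := face_sub_facet uD; rewrite FE => /set1P->.
  have [/eqP Fs|] := eqVneq (F :\: s) set0.
    have -> : s = F by apply/eqP; rewrite eqEsubset -DE sD -setD_eq0.
    by rewrite cardD // subrr; apply: acyclic_below_negative.
  case/set0Pn => x; rewrite inE => /andP[xs xF]; apply: (@acyclic_cone _ x) => u.
  rewrite !mem_link disjointsU1 !DE -setUA !(subUset _ [set x]) !sub1set xF xs.
  by case/and3P=> -> -> ->.
have [xD _] := sx.
have cl := vertex_link_complex cD xD; have cd := deletion_complex x cD.
have subD : forall s u, s \in D -> u \subset s -> u \in D by case: cD.
have [xs|xs] := boolP (x \in s).
  have sl : s :\ x \in vertex_link D x.
    by rewrite mem_vertex_link setD11 setD1K // sD (subD s) // subsetDl.
  have := IHl _ cl (vertex_link_card cD cardD) _ sl.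
  rewrite link_vertex_link // (cardsD1 x s) xs.
  (* A facet through [x] shows that [m] is positive, so the truncated [m.-1] is a genuine
     [m - 1]. *)
  have [F FD sF] := face_sub_facet sD.
  rewrite -(cardD F FD) (cardsD1 x F) (subsetP sF) //=.
  by congr acyclic_below; rewrite !PoszD; ring.
have sd : s \in deletion D x by rewrite mem_deletion sD.
have acd := IHd _ cd (deletion_card sx cardD) _ sd.
have [xsD|xsD] := boolP (x |: s \in D); last first.
  by rewrite -(deletion_link_id subD xsD) deletion_link.
have [_ sub_link] := link_complex cD sD.
apply: (@acyclic_link_deletion _ x); rewrite ?deletion_link //.
have sl : s \in vertex_link D x by rewrite mem_vertex_link sD xs.
have := IHl _ cl (vertex_link_card cD cardD) _ sl.
rewrite vertex_link_link //.
have [F FD /subsetP/(_ x)] := face_sub_facet xsD; rewrite setU11 => /(_ isT) xF.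
rewrite -(cardD F FD) (cardsD1 x F) xF /=.
by congr acyclic_below; rewrite !PoszD; ring.
Qed.

Lemma vd_cohen_macaulay D m : vertex_decomposable D -> simplicial_complex D ->
  {in facets D, forall F : {set 'I_n}, #|F| = m} -> cohen_macaulay K D.
Proof.
move=> vdD cD cardD s sD i i_lt; apply/eqP; rewrite diffv_eq0.
apply: (vd_acyclic_link vdD cD cardD sD); apply: lt_le_trans i_lt _.
rewrite lerD2r lerBrDr -PoszD lez_nat.
have face_card u : u \in D -> (#|u| <= m)%N.
  by move=> uD; have [F FD uF] := face_sub_facet uD; rewrite -(cardD F FD) subset_leq_card.
have /bigmax_leqP max_le : forall u, u \in link D s -> (#|u| <= m - #|s|)%N.
  move=> u; rewrite mem_link => /and3P[_ us usD].
  by rewrite leq_subRL ?face_card // addnC -cardsUI (disjoint_setI0 us) cards0 addn0 face_card.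
by rewrite -(subnK (face_card _ sD)) leq_add2r.
Qed.

(** The 0-cochain given by the indicator of [p]; it vanishes on the boundary of every edge whose
    ends agree on [p]. *)
Definition vertex_sum (p : pred 'I_n) (c : chain) : K^o := \sum_(z | p z) c [set z].

Fact vertex_sum_is_linear p : linear (vertex_sum p).
Proof.
move=> a c e; rewrite /vertex_sum scaler_sumr -big_split.
by apply: eq_bigr => z _; rewrite !ffunE.
Qed.

HB.instance Definition _ p := GRing.isLinear.Build K chain K^o *:%R (vertex_sum p)
  (vertex_sum_is_linear p).

Lemma vertex_sum_vertex p x : vertex_sum p (face_chain K [set x]) = (p x)%:R.
Proof.
rewrite /vertex_sum big_mkcond (bigD1 x) //= big1 => [|z zx].
  by rewrite ffunE eqxx addr0; case: (p x).
by rewrite ffunE (inj_eq set1_inj) (negPf zx) if_same.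
Qed.

Lemma vertex_sum_edge p x y : x != y -> p x = p y ->
  vertex_sum p (face_boundary K [set x; y]) = 0.
Proof.
move=> xy pxy; rewrite /face_boundary big_setU1 ?inE //= big_set1.
rewrite -/(face_sign x _) -/(face_sign y _).
rewrite setU1K ?inE // {2 3}setUC setU1K ?inE 1?eq_sym //.
rewrite linearD !linearZ /= !vertex_sum_vertex pxy -scalerDl !face_signU1.
rewrite -[[set y]]setU0 -[[set x]]setU0 !face_sign_add ?inE // 1?eq_sym //.
rewrite /face_sign !(eq_card0 (A := [set z in set0 | _])) => [|z|z]; rewrite ?inE //.
by case: ltngtP xy => [_ _|_ _|/val_inj->]; rewrite ?eqxx // expr0 expr1 !mulr1 ?subrr ?addNr scale0r.
Qed.

Lemma boundary_vertex x : boundary (face_chain K [set x]) = face_chain K set0.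
Proof.
rewrite boundary_face /face_boundary big_set1 setDv.
rewrite (eq_card0 (A := [set y in [set x] | _])) ?expr0 ?scale1r // => y.
by rewrite !inE; case: eqVneq => // ->; rewrite ltnn.
Qed.

(** The difference of two vertices is a reduced 0-cycle. The link has positive dimension, so this
    cycle bounds a combination of edges, which [vertex_sum p] kills. *)
Lemma cohen_macaulay_link_connected D s (p : pred 'I_n) :
    cohen_macaulay K D -> s \in D ->
    (exists2 u, u \in link D s & (1 < #|u|)%N) ->
    (forall x y, x != y -> [set x; y] \in link D s -> p x = p y) ->
  forall x y, [set x] \in link D s -> [set y] \in link D s -> p x = p y.
Proof.
move=> cmD sD [u ul u2] conn x y xl yl.
have dim_gt0 : (0 < Defs.dim (link D s))%R.
  by rewrite subr_gt0 ltz_nat; apply: leq_trans u2 _; apply: leq_bigmax_cond.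
have /eqP := cmD s sD 0 dim_gt0; rewrite diffv_eq0 => /subvP cyc_bnd.
pose c := face_chain K [set x] - face_chain K [set y].
have : c \in boundaries K (link D s) 0.
  apply: cyc_bnd; rewrite memv_cap memv_ker linearB /= !boundary_vertex subrr eqxx andbT.
  apply/mem_chainsP => v; rewrite !ffunE.
  have [->|_] := eqVneq v [set x]; first by rewrite xl cards1.
  have [->|_] := eqVneq v [set y]; first by rewrite yl cards1.
  by rewrite subrr eqxx.
move=> /memv_imgP[e /mem_chainsP eD cE].
have : vertex_sum p c = 0.
  rewrite cE [e]chain_sum !linear_sum big1 // => v _; rewrite !linearZ /= boundary_face.
  have [->|/eD[vl v2]] := eqVneq (e v) 0; first by rewrite scale0r.
  have /eqP/cards2P[a [b [ab vE]]] : #|v| = 2%N by lia.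
  by rewrite vE vertex_sum_edge ?scaler0 //; apply: conn; rewrite -?vE.
rewrite linearB /= !vertex_sum_vertex => /eqP.
by case: (p x) (p y) => [] []; rewrite // ?subr0 ?sub0r ?oppr_eq0 oner_eq0.
Qed.

End Acyclic.

(** * Families of monotone paths *)

Section MonotonePaths.
Variables (T : finType) (n : nat) (e : nat -> nat -> T).
Implicit Types (l u f g : nat -> nat) (S : pred nat) (A : {set {set T}}) (F : {set T}).

Definition nondecreasing f : Prop := forall i j, i <= j < n -> f i <= f j.

Definition between l u f : Prop :=
  (forall i, i < n -> l i <= f i <= u i) /\ nondecreasing f.

(** [S] holds the columns whose vertex has not been removed by a link. The other columns still
    constrain [f] through monotonicity. *)
Definition path_face S f : {set T} := [set e i (f i) | i : 'I_n & S i].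

(** A relation, since [f] ranges over all functions on [nat], which differ outside the columns. *)
Definition path_family S l u A : Prop :=
  forall F, F \in A <-> exists2 f, between l u f & F = path_face S f.

Definition separated l u : Prop := forall f, between l u f ->
  forall i j, i < n -> j < n -> e i (f i) = e j (f j) -> i = j.

Lemma path_faceP S f x :
  reflect (exists i, [/\ i < n, S i & x = e i (f i)]) (x \in path_face S f).
Proof.
apply: (iffP imsetP) => [[i iS ->]|[i [i_n Si ->]]].
  by exists i; rewrite inE in iS.
by exists (Ordinal i_n); rewrite ?inE.
Qed.

Lemma eq_path_face S f g : (forall i, i < n -> f i = g i) -> path_face S f = path_face S g.
Proof. by move=> fg; apply: eq_imset => i; rewrite fg. Qed.

Lemma card_path_face S l u f : separated l u -> between l u f ->
  #|path_face S f| = #|[set i : 'I_n | S i]|.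
Proof.
move=> sep fb; rewrite card_in_imset ?cardsE // => i j _ _ /(sep f fb _ _) ij.
by apply: val_inj; apply: ij.
Qed.

Lemma path_face_remove S f i : i < n ->
    (forall j, j < n -> e j (f j) = e i (f i) -> j = i) ->
  path_face S f :\ e i (f i) = path_face (fun j => S j && (j != i)) f.
Proof.
move=> i_n inj; apply/setP=> x; rewrite in_setD1.
apply/andP/path_faceP => [[xi /path_faceP[j [j_n Sj xE]]]|[j [j_n /andP[Sj ji] ->]]].
  by exists j; rewrite Sj xE; split=> //; apply: contraNneq xi => <-; rewrite xE.
split; last by apply/path_faceP; exists j.
by apply: contraNneq ji => /inj->.
Qed.

(** * Vertex-decomposability of path families *)

Lemma path_family_single S l u A : nondecreasing l -> (forall i, i < n -> l i = u i) ->
  path_family S l u A -> vertex_decomposable (generated A).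
Proof.
move=> mono_l lu famA; suff -> : A = [set path_face S l] by apply: generated1_vd.
apply/setP=> F; rewrite in_set1; apply/idP/eqP => [/famA[f [fb _] ->]|->].
  by apply: eq_path_face => i i_n; have := fb i i_n; rewrite lu //; lia.
by apply/famA; exists l => //; split=> // i i_n; rewrite leqnn lu /=.
Qed.

(** An instance of [vd_generated_step] at the vertex [e i a]: avoiding it and containing it must
    again be expressible by bounds, so that deletion and link are path families, the link without
    column [i]. *)
Lemma path_family_step S l u l0 u0 l1 u1 A i a : i < n -> S i -> separated l u ->
    (forall f j, between l u f -> j < n -> e j (f j) = e i a -> j = i /\ f i = a) ->
    (forall f, between l0 u0 f <-> between l u f /\ f i <> a) ->
    (forall f, between l1 u1 f <-> between l u f /\ f i = a) ->
    (exists f, between l1 u1 f) ->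
    (forall f, between l1 u1 f -> exists2 g, between l0 u0 g &
       path_face S f :\ e i a \subset path_face S g) ->
    path_family S l u A ->
    (forall A0, path_family S l0 u0 A0 -> vertex_decomposable (generated A0)) ->
    (forall A1, path_family (fun j => S j && (j != i)) l1 u1 A1 ->
       vertex_decomposable (generated A1)) ->
  vertex_decomposable (generated A).
Proof.
move=> i_n Si sep sepx b0 b1 [h hb] exch famA vd0 vd1.
have mem_x f : between l u f -> (e i a \in path_face S f) = (f i == a).
  move=> fb; apply/path_faceP/eqP => [[j [j_n _ /esym/(sepx f j fb j_n)[]]]//|fa].
  by exists i; rewrite fa.
have rem_x f : between l u f -> f i = a ->
    path_face S f :\ e i a = path_face (fun j => S j && (j != i)) f.
  move=> fb fa; rewrite -fa path_face_remove // => j j_n.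
  by rewrite fa => /(sepx f j fb j_n)[].
apply: (@vd_generated_step _ _ #|[set i : 'I_n | S i]| (e i a)).
- by move=> F /famA[f fb ->]; apply: card_path_face sep fb.
- have [hb' ha] := (b1 h).1 hb.
  by exists (path_face S h); [apply/famA; exists h | rewrite mem_x ?ha].
- move=> _ /famA[f fb ->]; rewrite mem_x // => /eqP fa.
  have [|g gb fg] := exch f; first exact/b1.
  have [gb' /eqP ga] := (b0 g).1 gb.
  by exists (path_face S g); [apply/famA; exists g | rewrite mem_x // ga].
- apply: vd0 => F; rewrite inE; split=> [/andP[/famA[f fb ->]]|[f /b0[fb /eqP fa] ->]].
    by rewrite mem_x // => /eqP fa; exists f => //; apply/b0.
  by rewrite mem_x // fa andbT; apply/famA; exists f.
apply: vd1 => F; split=> [/imsetP[_ /setIdP[/famA[f fb ->]]]|[f /b1[fb fa] ->]].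
  rewrite mem_x // => /eqP fa ->; exists f; first exact/b1.
  exact: rem_x.
apply/imsetP; exists (path_face S f); last by rewrite rem_x.
by rewrite inE mem_x // fa eqxx andbT; apply/famA; exists f.
Qed.

Lemma gap_sum_lt l u l' u' i : i < n -> u' i - l' i < u i - l i ->
    (forall j, j < n -> u' j - l' j <= u j - l j) ->
  \sum_(j < n) (u' j - l' j) < \sum_(j < n) (u j - l j).
Proof.
move=> i_n lt_i le_j; rewrite (bigD1 (Ordinal i_n)) //= [ltnRHS](bigD1 (Ordinal i_n)) //=.
by rewrite -addSn leq_add // leq_sum // => j _; apply: le_j.
Qed.

(** Selects the column to branch on; beyond it every path is forced. *)
Lemma last_gap l u : (forall i, i < n -> l i <= u i) ->
  (forall i, i < n -> l i = u i) \/
  (exists i, [/\ i < n, l i < u i & forall j, i < j < n -> l j = u j]).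
Proof.
move=> lu; have [/existsP[i0 lu_i0]|no_gap] := boolP [exists i : 'I_n, l i < u i].
  have exP : exists i, (i < n) && (l i < u i) by exists i0; rewrite ltn_ord.
  have ubP i : (i < n) && (l i < u i) -> i <= n by case/andP=> /ltnW.
  right; have [i /andP[i_n lu_i] max_i] := ex_maxnP exP ubP.
  exists i; split=> // j /andP[ij j_n]; have := lu j j_n; have := max_i j.
  by rewrite j_n /=; case: ltngtP => // _ /(_ isT); lia.
left=> i i_n; have := lu i i_n; move/existsPn/(_ (Ordinal i_n)): no_gap => /=; lia.
Qed.

Lemma between_refl l u : nondecreasing l -> (forall i, i < n -> l i <= u i) -> between l u l.
Proof. by move=> mono_l lu; split=> // i i_n; rewrite leqnn lu. Qed.

Lemma diagonal_paths_vd S l u A :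
    (forall i j k k', i < n -> j < n -> k <= u i -> k' <= u j ->
       e i k = e j k' <-> i + k = j + k') ->
    nondecreasing l -> nondecreasing u -> (forall i, i < n -> l i <= u i) ->
    (forall i, i < n -> l i < u i -> S i) ->
  path_family S l u A -> vertex_decomposable (generated A).
Proof.
have [m] := ubnP (\sum_(j < n) (u j - l j)).
elim: m => // m IH in S l u A *; rewrite ltnS => le_m eE mono_l mono_u lu Slu famA.
have [/path_family_single|[i [i_n lt_i eq_gt]]] := last_gap lu; first exact.
(* Since [f] is nondecreasing, [f i < u i] caps all columns up to [i]. Forcing [f i = u i] only
   raises the lower bound in column [i]. *)
pose u0 j := if j <= i then minn (u j) (u i).-1 else u j.
pose l1 j := if j == i then u i else l j.
have b0 f : between l u0 f <-> between l u f /\ f i <> u i.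
  split=> [[fb mono_f]|[[fb mono_f] fi]]; split.
  - by split=> // j j_n; have := fb j j_n; rewrite /u0; case: (leqP j i); lia.
  - by have := fb i i_n; rewrite /u0 leqnn; lia.
  - move=> j j_n; have := fb j j_n; have := fb i i_n; rewrite /u0; case: (leqP j i) => // ji.
    by have := mono_f j i; rewrite ji i_n => /(_ isT); lia.
  - exact: mono_f.
have b1 f : between l1 u f <-> between l u f /\ f i = u i.
  split=> [[fb mono_f]|[[fb mono_f] fi]]; split.
  - split=> // j j_n; have := fb j j_n; rewrite /l1.
    by case: eqP => // ->; lia.
  - by have := fb i i_n; rewrite /l1 eqxx; lia.
  - move=> j j_n; have := fb j j_n; rewrite /l1.
    by case: eqP => // ->; rewrite fi leqnn.
  - exact: mono_f.
have u_i j : i < j < n -> u i <= u j by case/andP=> ij j_n; apply: mono_u; rewrite j_n ltnW.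
have mono_l1 : nondecreasing l1.
  move=> j k /andP[jk k_n]; have := mono_l j k; rewrite jk k_n /l1 => /(_ isT).
  case: eqP jk => [->|ji] jk; case: eqP jk => [->|ki] jk //; last by lia.
  by have := u_i k; have := eq_gt k; rewrite k_n andbT; lia.
have mono_u0 : nondecreasing u0.
  move=> j k /andP[jk k_n]; have := mono_u j k; rewrite jk k_n /u0 => /(_ isT).
  by have := u_i k; rewrite k_n andbT; case: (leqP j i); case: (leqP k i); lia.
have lu0 j : j < n -> l j <= u0 j.
  move=> j_n; have := lu j j_n; rewrite /u0; case: (leqP j i) => // ji.
  by have := mono_l j i; rewrite ji i_n => /(_ isT); lia.
have lu1 j : j < n -> l1 j <= u j.
  by move=> /lu; rewrite /l1; case: eqP => // ->.
apply: (path_family_step i_n (Slu i i_n lt_i) _ _ b0 b1 _ _ famA).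
- move=> f [fb mono_f] j k j_n k_n.
  have [_ fj] := andP (fb j j_n); have [_ fk] := andP (fb k k_n).
  move=> /(eE _ _ _ _ j_n k_n fj fk).
  (* Along a nondecreasing [f], the diagonal index [j + f j] is strictly increasing. *)
  by have := mono_f j k; have := mono_f k j; rewrite j_n k_n !andbT; lia.
- move=> f j [fb mono_f] j_n.
  have [_ fj] := andP (fb j j_n); move=> /(eE _ _ _ _ j_n i_n fj (leqnn _)).
  have := mono_u j i; rewrite i_n andbT; have := fb j j_n.
  have := u_i j; have := eq_gt j; rewrite j_n andbT => eq_j u_j fj_lu u_ij jf.
  (* A column before [i] has bound at most [u i], and one after [i] is forced to a row at least
     [u i]; either way its diagonal differs from that of the top entry of column [i]. *)
  have ji : j = i by lia.
  by split=> //; move: jf; rewrite ji; lia.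
- by exists l1; apply: between_refl.
- move=> f /b1[[fb mono_f] fi].
  pose g j := if j <= i then minn (f j) (u i).-1 else f j.
  exists g.
    split=> [j j_n|j k /andP[jk k_n]].
      have := fb j j_n; have := lu0 j j_n; rewrite /g /u0; case: (leqP j i) => // ji; lia.
    have := mono_f j k; rewrite jk k_n /g => /(_ isT).
    by case: (leqP j i); case: (leqP k i); lia.
  apply/subsetP=> x; rewrite in_setD1 => /andP[xi /path_faceP[j [j_n Sj xE]]].
  have [gj|gj] := eqVneq (g j) (f j).
    by apply/path_faceP; exists j; rewrite gj.
  (* The entries of [f] at [j], ..., [i] all equal [u i]; those of [g] are one
     smaller, so the vertex of [f] in column [j] is that of [g] in column [j + 1]. *)
  have [ji fj] : j <= i /\ f j = u i.
    have := mono_f j i; rewrite i_n andbT fi; move: gj; rewrite /g.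
    by case: (leqP j i); lia.
  have ji' : j < i by rewrite ltn_neqAle ji andbT; apply: contraNneq xi => ij; rewrite xE ij fi.
  have fj1 : f j.+1 = u i.
    by have := mono_f j j.+1; have := mono_f j.+1 i; rewrite fj fi ji' i_n; lia.
  have j1_n : j.+1 < n by apply: leq_ltn_trans i_n.
  have fb1 := fb _ j1_n.
  apply/path_faceP; exists j.+1; split=> //.
    (* Column [j.+1] has a gap, hence lies in [S]: [l j.+1 <= l i < u i = f j.+1 <= u j.+1]. *)
    by apply: Slu => //; have := mono_l j.+1 i; rewrite ji' i_n => /(_ isT); lia.
  rewrite xE /g ji' fj1; apply/eE => //; last by lia.
    by have /andP[] := fb j j_n.
  by lia.
- move=> A0; apply: IH => //.
  + apply: leq_trans le_m; apply: gap_sum_lt i_n _ _ => [|j j_n].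
      by rewrite /u0 leqnn; lia.
    by rewrite leq_sub2r // /u0; case: (leqP j i); lia.
  + move=> j k a b j_n k_n aj bk; apply: eE => //.
      by apply: leq_trans aj _; rewrite /u0; case: (leqP j i); lia.
    by apply: leq_trans bk _; rewrite /u0; case: (leqP k i); lia.
  + by move=> j j_n lj; apply: Slu => //; move: lj; rewrite /u0; case: (leqP j i); lia.
- move=> A1; apply: IH => //.
  + apply: leq_trans le_m; apply: gap_sum_lt i_n _ _ => [|j j_n].
      by rewrite /l1 eqxx; lia.
    by rewrite leq_sub2l // /l1; case: eqP => // ->; apply: ltnW.
  + by move=> j j_n; rewrite /l1; case: eqP => [->|_ /(Slu j j_n)->]; rewrite ?ltnn.
Qed.

Lemma disjoint_columns_vd S l u A :
    (forall i j k k', i < n -> j < n -> l i <= k <= u i -> l j <= k' <= u j ->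
       e i k = e j k' -> i = j /\ k = k') ->
    nondecreasing l -> nondecreasing u -> (forall i, i < n -> l i <= u i) ->
    (forall i, i < n -> l i < u i -> S i) ->
  path_family S l u A -> vertex_decomposable (generated A).
Proof.
have [m] := ubnP (\sum_(j < n) (u j - l j)).
elim: m => // m IH in S l u A *; rewrite ltnS => le_m eI mono_l mono_u lu Slu famA.
have [/path_family_single|[i [i_n lt_i eq_gt]]] := last_gap lu; first exact.
(* Now the deletion raises the lower bound in column [i] only, while the link, with [f i = l i],
   caps all columns up to [i]. *)
pose l0 j := if j == i then (l i).+1 else l j.
pose u1 j := if j <= i then minn (u j) (l i) else u j.
have b0 f : between l0 u f <-> between l u f /\ f i <> l i.
  split=> [[fb mono_f]|[[fb mono_f] fi]]; split.
  - split=> // j j_n; have := fb j j_n; rewrite /l0.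
    by case: eqP => // ->; lia.
  - by have := fb i i_n; rewrite /l0 eqxx; lia.
  - move=> j j_n; have := fb j j_n; rewrite /l0.
    by case: eqP => // ->; lia.
  - exact: mono_f.
have b1 f : between l u1 f <-> between l u f /\ f i = l i.
  split=> [[fb mono_f]|[[fb mono_f] fi]]; split.
  - by split=> // j j_n; have := fb j j_n; rewrite /u1; case: (leqP j i); lia.
  - by have := fb i i_n; rewrite /u1 leqnn; lia.
  - move=> j j_n; have := fb j j_n; rewrite /u1; case: (leqP j i) => // ji.
    by have := mono_f j i; rewrite ji i_n => /(_ isT); lia.
  - exact: mono_f.
have u_i j : i < j < n -> u i <= u j by case/andP=> ij j_n; apply: mono_u; rewrite j_n ltnW.
have mono_l0 : nondecreasing l0.
  move=> j k /andP[jk k_n]; have := mono_l j k; rewrite jk k_n /l0 => /(_ isT).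
  case: eqP jk => [->|ji] jk; case: eqP jk => [->|ki] jk //; last by lia.
  by have := u_i k; have := eq_gt k; rewrite k_n andbT; lia.
have mono_u1 : nondecreasing u1.
  move=> j k /andP[jk k_n]; have := mono_u j k; rewrite jk k_n /u1 => /(_ isT).
  by have := u_i k; rewrite k_n andbT; case: (leqP j i); case: (leqP k i); lia.
have lu0 j : j < n -> l0 j <= u j.
  by move=> /lu; rewrite /l0; case: eqP => // ->.
have lu1 j : j < n -> l j <= u1 j.
  move=> j_n; have := lu j j_n; rewrite /u1; case: (leqP j i) => // ji.
  by have := mono_l j i; rewrite ji i_n => /(_ isT); lia.
have l_i : l i <= l i <= u i by rewrite leqnn lu.
apply: (path_family_step i_n (Slu i i_n lt_i) _ _ b0 b1 _ _ famA).
- by move=> f [fb _] j k j_n k_n /(eI _ _ _ _ j_n k_n (fb j j_n) (fb k k_n))[].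
- move=> f j [fb _] j_n /(eI _ _ _ _ j_n i_n (fb j j_n) l_i)[ji fj].
  by rewrite -ji fj ji.
- by exists l; apply: between_refl.
- move=> f /b1[[fb mono_f] fi].
  pose g j := if j == i then (l i).+1 else f j.
  exists g.
    split=> [j j_n|j k /andP[jk k_n]].
      have := fb j j_n; have := lu0 j j_n; rewrite /g /l0.
      by case: eqP => // ->; rewrite leqnn.
    have := mono_f j k; rewrite jk k_n /g => /(_ isT).
    case: eqP jk => [->|ji] jk; case: eqP jk => [->|ki] jk //; last by lia.
    (* A column [k] after [i] is forced to [u k >= u i], which leaves room to raise column [i] by
       one. *)
    by have := u_i k; have := eq_gt k; have := fb k k_n; rewrite k_n andbT; lia.
  apply/subsetP=> x; rewrite in_setD1 => /andP[xi /path_faceP[j [j_n Sj xE]]].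
  apply/path_faceP; exists j; split=> //; rewrite xE /g; case: eqP => // ji.
  by rewrite xE ji fi eqxx in xi.
- move=> A0; apply: IH => //.
  + apply: leq_trans le_m; apply: gap_sum_lt i_n _ _ => [|j j_n].
      by rewrite /l0 eqxx; lia.
    by rewrite leq_sub2l // /l0; case: eqP => // ->.
  + move=> j k a b j_n k_n aj bk; apply: eI => //.
      by move: aj; rewrite /l0; case: eqP => // ->; lia.
    by move: bk; rewrite /l0; case: eqP => // ->; lia.
  + by move=> j j_n lj; apply: Slu => //; move: lj; rewrite /l0; case: eqP => // ->; lia.
- move=> A1; apply: IH => //.
  + apply: leq_trans le_m; apply: gap_sum_lt i_n _ _ => [|j j_n].
      by rewrite /u1 leqnn; lia.
    by rewrite leq_sub2r // /u1; case: (leqP j i); lia.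
  + move=> j k a b j_n k_n aj bk; apply: eI => //.
      by move: aj; rewrite /u1; case: (leqP j i); lia.
    by move: bk; rewrite /u1; case: (leqP k i); lia.
  + move=> j j_n; rewrite /u1; case: (eqVneq j i) => [->|ji]; first by rewrite leqnn; lia.
    by case: (leqP j i) => _ lj; rewrite Slu //; lia.
Qed.

End MonotonePaths.

(** * Young complexes *)

Section LinkSplit.
Variables (K : fieldType) (n : nat).
Implicit Types (D : {set {set 'I_n}}) (s u F G H : {set 'I_n}).

(** The two lemmas below make such a [p] globally constant, for shellable and for Cohen-Macaulay
    complexes, with the same conclusion, so that one pair of facets refutes both. *)
Definition link_split D s (p : pred 'I_n) : Prop := forall F, F \in facets D -> s \subset F ->
  1 < #|F :\: s| /\ {in F :\: s &, forall x y, p x = p y}.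

Lemma shellable_link_connected D s (p : pred 'I_n) : shellable D -> link_split D s p ->
  forall F G, F \in facets D -> G \in facets D -> s \subset F -> s \subset G ->
  forall x y, x \in F :\: s -> y \in G :\: s -> p x = p y.
Proof.
move=> [_ [Fs [_ Fs_mem shFs]]] split_p F G; rewrite -!Fs_mem.
apply: exchange_order_link_connected (shelling_exchange shFs) _ F G => H.
by rewrite Fs_mem; apply: split_p.
Qed.

Lemma cm_link_connected D s (p : pred 'I_n) : simplicial_complex D ->
    cohen_macaulay K D -> link_split D s p ->
  forall F G, F \in facets D -> G \in facets D -> s \subset F -> s \subset G ->
  forall x y, x \in F :\: s -> y \in G :\: s -> p x = p y.
Proof.
move=> [_ subD] cmD split_p F G FD GD sF sG x y xF yG.
have linkP H u : H \in facets D -> s \subset H -> u \subset H :\: s -> u \in link D s.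
  move=> /facet_face HD sH; rewrite subsetD => /andP[uH us].
  by rewrite mem_link us (subD _ _ HD) // (subD _ _ HD) // subUset uH.
apply: (cohen_macaulay_link_connected cmD (subD _ _ (facet_face FD) sF)).
- by exists (F :\: s); [apply: linkP FD sF _ | case: (split_p F FD sF)].
- move=> a b ab; rewrite mem_link => /and3P[_ abs /face_sub_facet[H HD]].
  rewrite subUset => /andP[abH sH]; case: (split_p H HD sH) => _; apply.
    by rewrite (subsetP (_ : [set a; b] \subset _)) ?subsetD ?abH ?set21.
  by rewrite (subsetP (_ : [set a; b] \subset _)) ?subsetD ?abH ?set22.
- by apply: linkP FD sF _; rewrite sub1set.
- by apply: linkP GD sG _; rewrite sub1set.
Qed.

End LinkSplit.

(** Both sides say that a box lies in the diagram: the left by the length of row [j], the right by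
    the height of column [i], a part of the conjugate partition. *)
Lemma nth_sorted_count (s : seq nat) i j : sorted geq s ->
  (i < nth 0 s j) = (j < count (fun x => i < x) s).
Proof.
elim: s j => [|a s IH] j; first by rewrite nth_nil ltn0.
move=> /= ss; have IHs k := IH k (path_sorted ss).
have count0 : a <= i -> count (fun x => i < x) s = 0.
  move=> ai; rewrite (@eq_in_count _ _ pred0) ?count_pred0 // => x.
  move=> /(allP (order_path_min (rev_trans leq_trans) ss)) /= xa.
  by rewrite ltnNge (leq_trans xa ai).
by case: j => [|j] /=; rewrite ?IHs; case: (ltnP i a) => //= /count0->.
Qed.

(** * Facets of Young complexes as monotone paths *)

Section Young.
Variables (la : seq nat) (t : nat).
Hypotheses (hla : is_partition la) (t_gt0 : 0 < t).
Local Notation r := (size la).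
Local Notation n := (part la 1).

(* Rows are now numbered from 0 upwards from the bottom row and columns from 0,
   so that the entry of row [k] in column [i] is [k * t + i.+1]. *)
Definition young_low i := r - count (fun x => i < x) la.
Definition young_top (i : nat) := r.-1.
Definition young_vertex i k : 'I_(young_max la t).+1 := inord (k * t + i.+1).

Lemma mem_young_column i v :
  v \in young_column la t i.+1 <-> exists2 k, young_low i <= k < r & v = k * t + i.+1.
Proof.
have [_ la_sorted _] := and3P hla.
have count_r := count_size (fun x => i < x) la.
rewrite /young_low; split=> [/mapP[j]|[k k_r ->]].
  rewrite mem_filter mem_iota /part nth_sorted_count // => /and3P[ij j1 jr] ->.
  by exists (r - j); rewrite //; lia.
apply/mapP; exists (r - k); last by rewrite /young_entry subKn //; lia.
by rewrite mem_filter mem_iota /part nth_sorted_count //; lia.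
Qed.

Lemma young_low_le i : i < n -> young_low i <= r.-1.
Proof.
have [_ la_sorted _] := and3P hla.
by rewrite /part nth_sorted_count // /young_low; lia.
Qed.

Lemma two_rows i : i < part la 2 -> 1 < r /\ i < n.
Proof.
have [_ la_sorted _] := and3P hla; have := count_size (fun x => i < x) la.
by rewrite /part !nth_sorted_count //=; lia.
Qed.

Lemma young_low_nondecreasing : nondecreasing n young_low.
Proof.
move=> i j /andP[ij _]; apply: leq_sub2l; apply: sub_count => x.
exact: leq_ltn_trans.
Qed.

Lemma young_vertexE i k : i < n -> k <= r.-1 -> young_vertex i k = k * t + i.+1 :> nat.
Proof.
move=> i_n k_r; rewrite /young_vertex inordK // ltnS leq_add // leq_mul2r k_r orbT //.
Qed.

Lemma nondecreasingS m f : (forall i, i.+1 < m -> f i <= f i.+1) -> nondecreasing m f.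
Proof.
move=> fS i j /andP[/subnKC <-]; elim: (j - i) => [|d IH]; first by rewrite addn0.
by rewrite addnS => id_m; apply: leq_trans (IH (ltnW id_m)) (fS _ id_m).
Qed.

Lemma nth_val_tuple m N (a : m.-tuple 'I_N) (i : 'I_m) :
  nth 0 [seq val x | x <- a] i = val (tnth a i).
Proof.
by rewrite (nth_map (tnth_default a i)) ?size_tuple // -tnth_nth.
Qed.

(** For consecutive columns, [k * t + i.+1 < k' * t + i.+2] amounts to [k <= k'] because [t] is
    positive, so increasing entries correspond to nondecreasing rows. *)
Lemma young_facets_family :
  path_family n young_vertex predT young_low young_top (young_facets la t).
Proof.
move=> A; split.
  rewrite inE => /existsP[a /and3P[/(sortedP 0) a_sorted /forallP a_col /eqP ->]].
  pose w i := nth 0 [seq val x | x <- a] i.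
  pose f i := (w i - i.+1) %/ t.
  have fE i : i < n -> young_low i <= f i <= r.-1 /\ w i = f i * t + i.+1.
    move=> i_n; have := a_col (Ordinal i_n); rewrite -nth_val_tuple -/(w _).
    move=> /mem_young_column[k /= k_r wE]; rewrite /f wE addnK mulnK //.
    by split=> //; lia.
  exists f.
    split=> [i i_n|]; first by case: (fE i i_n).
    apply: nondecreasingS => i i1_n.
    have := a_sorted i; rewrite size_map size_tuple -/(w i) -/(w i.+1) => /(_ i1_n).
    case: (fE i (ltnW i1_n)) => _ ->; case: (fE _ i1_n) => _ ->.
    by rewrite /= [_ + i.+2]addnS ltnS leq_add2r leq_mul2r; lia.
  apply/setP=> x; rewrite inE; apply/tnthP/path_faceP => [[i ->]|[i [i_n _ ->]]].
    exists i; split=> //; apply: val_inj; have [fi wi] := fE i (ltn_ord i).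
    rewrite /= young_vertexE -?wi //; last by case/andP: fi.
    by rewrite -nth_val_tuple.
  exists (Ordinal i_n); apply: val_inj; have [fi wi] := fE i i_n.
  rewrite /= young_vertexE -?wi //; last by case/andP: fi.
  by rewrite -nth_val_tuple.
move=> [f [fb mono_f] ->]; rewrite inE; apply/existsP.
have eE i : i < n -> young_vertex i (f i) = f i * t + i.+1 :> nat.
  by move=> i_n; have /andP[_ fi] := fb i i_n; rewrite young_vertexE.
pose a := [tuple young_vertex i (f i) | i < n].
have nth_a i : i < n -> nth 0 [seq val x | x <- a] i = f i * t + i.+1.
  by move=> i_n; rewrite (nth_val_tuple a (Ordinal i_n)) tnth_mktuple /= eE.
exists a; apply/and3P; split.
- apply/(sortedP 0) => i; rewrite size_map size_tuple => i1_n.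
  rewrite !nth_a //=; last exact: ltnW.
  by have := mono_f i i.+1; rewrite leqnSn i1_n => /(_ isT); nia.
- apply/forallP=> i; rewrite tnth_mktuple /= eE //; apply/mem_young_column.
  by exists (f i) => //; have := fb i (ltn_ord i); rewrite /young_top; have [] := and3P hla; lia.
apply/eqP/setP=> x; rewrite inE; apply/path_faceP/tnthP => [[i [i_n _ ->]]|[i ->]].
  by exists (Ordinal i_n); rewrite tnth_mktuple.
by exists i; rewrite tnth_mktuple.
Qed.

(** * Vertex-decomposable Young complexes and the obstruction *)

Lemma young_top_nondecreasing : nondecreasing n young_top.
Proof. by []. Qed.

Lemma young_complex_vd_diagonal : t = 1 -> vertex_decomposable (young_complex la t).
Proof.
move=> t1; apply: (diagonal_paths_vd _ young_low_nondecreasing young_top_nondecreasing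
  _ _ young_facets_family) => [i j k k' i_n j_n k_r k'_r|i|//].
  split=> [/(congr1 val)|ij]; first by rewrite /= !young_vertexE //; lia.
  by apply: val_inj; rewrite /= !young_vertexE //; lia.
exact: young_low_le.
Qed.

Lemma young_low_second i : part la 2 <= i -> r.-1 <= young_low i.
Proof.
have [_ la_sorted _] := and3P hla.
rewrite leqNgt /part nth_sorted_count // /young_low; lia.
Qed.

Lemma young_complex_vd_columns : part la 2 <= t -> vertex_decomposable (young_complex la t).
Proof.
move=> la2; apply: (disjoint_columns_vd _ young_low_nondecreasing young_top_nondecreasing
  _ _ young_facets_family) => [i j k k' i_n j_n k_r k'_r|i|//]; last exact: young_low_le.
(* If equal entries had [i < j], then [k' < k] and [j - i] would be a positive multiple of [t]. So
   [j >= t >= la_2], and column [j] has only its top box, contradicting [k' < k]. *)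
have col_le : forall i j k k', i < n -> j < n -> young_low i <= k <= young_top i ->
    young_low j <= k' <= young_top j -> k * t + i.+1 = k' * t + j.+1 -> j <= i.
  move=> {}i {}j {}k {}k' {}i_n {}j_n {}k_r {}k'_r kE; rewrite leqNgt; apply/negP => ij.
  have k'k : k' < k by nia.
  have tj : t <= j by nia.
  by have := young_low_second (leq_trans la2 tj); rewrite /young_top in k_r; lia.
move=> /(congr1 val); rewrite /= !young_vertexE //; try by rewrite /young_top in k_r k'_r; lia.
move=> kE; have ij : i = j.
  by apply/eqP; rewrite eqn_leq (col_le _ _ _ _ i_n j_n k_r k'_r kE) andbT;
     apply: (col_le _ _ _ _ j_n i_n k'_r k_r (esym kE)).
by split=> //; move: kE; rewrite ij; nia.
Qed.

(* The entry of the top row in column [0] is also the entry of the row below in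
   column [t]. *)
Definition young_split_face : {set 'I_(young_max la t).+1} :=
  path_face n young_vertex (fun i => (i == 0) || (t < i)) young_top.

(** Descending induction on the column. The top entry of column [i] can reappear on the path only in
    a column [j >= i]; if [j > i], then [f j] is already the top row and the entry is too large. *)
Lemma young_face_rows f i : nondecreasing n f -> (forall i, i < n -> f i <= r.-1) ->
    young_split_face \subset path_face n young_vertex predT f ->
  t < i < n -> f i = r.-1.
Proof.
move=> mono_f f_r /subsetP sub; have [d] := ubnP (n - i).
elim: d i => // d IH i; rewrite ltnS => le_d /andP[ti i_n].
have /sub/path_faceP[j [j_n _]] : young_vertex i r.-1 \in young_split_face.
  by apply/path_faceP; exists i; rewrite ti orbT.
move/(congr1 val); rewrite /= !young_vertexE ?f_r // => iE.
have ij : i <= j by have := leq_mul (f_r j j_n) (leqnn t); lia.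
have [ji|ij'] := leqP j i.
  have {ij ji} ij : i = j by lia.
  by move: iE; rewrite -ij => /addIn/eqP; rewrite eqn_pmul2r // => /eqP->.
by move: iE; rewrite (IH j) //; lia.
Qed.

Lemma young_link_split : 2 <= t -> t < part la 2 ->
  link_split (young_complex la t) young_split_face (fun x => (r.-1 * t).+1 < x).
Proof.
move=> t2 la2 F; rewrite facets_young_complex => F_facet sF.
have [f [fb mono_f] FE] := (young_facets_family F).1 F_facet.
have f_r i : i < n -> f i <= r.-1 by move=> /fb/andP[].
have [r_gt1 tn] := two_rows la2.
split.
  rewrite cardsD (setIidPr sF) (card_young_facet F_facet).
  have lt1 : 1 < n by apply: ltn_trans tn.
  have lt2 : 2 < n by apply: leq_ltn_trans tn.
  (* The split face skips columns 1 and 2, which exist since [2 <= t < n]. *)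
  apply: leq_trans (leq_sub2l n (leq_imset_card _ _)).
  set P := finset _; have := cardsC P; rewrite card_ord.
  have /subset_leq_card : [set Ordinal lt1; Ordinal lt2] \subset ~: P.
    by rewrite subUset !sub1set !inE /= -!leqNgt t2 (ltnW t2).
  by rewrite cards2 /=; lia.
have [j [j_n _ jE]] : exists j, [/\ j < n, true & young_vertex 0 r.-1 = young_vertex j (f j)].
  apply/path_faceP; rewrite -FE; apply: (subsetP sF); apply/path_faceP.
  by exists 0; split=> //; apply: leq_ltn_trans tn.
have jv : r.-1 * t = f j * t + j.
  by move/(congr1 val): jE; rewrite /= !young_vertexE ?f_r //; lia.
(* The column [j] in which the facet meets the shared entry decides on which side of it all
   remaining vertices lie. *)
suff below x : x \in F :\: young_split_face -> ((r.-1 * t).+1 < x) = (j == 0).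
  by move=> x y /below-> /below->.
rewrite in_setD FE => /andP[xs /path_faceP[i [i_n _ xE]]].
rewrite xE young_vertexE ?f_r // jv.
have ij : i <> j.
  move=> ij; case/negP: xs; apply/path_faceP; exists 0.
  by rewrite xE ij -jE; split=> //; apply: leq_ltn_trans tn.
have [i_lt|j_le] := ltnP i j.
  have := mono_f i j; rewrite (ltnW i_lt) j_n => /(_ isT) fij.
  by have := leq_mul fij (leqnn t); lia.
have ji : j < i by lia.
have := mono_f j i; rewrite (ltnW ji) i_n => /(_ isT) fji.
have := leq_mul fji (leqnn t).
have [j0|j0] := posnP j; first by lia.
(* With [j > 0] the shared entry is met below the top row, so [j >= t]. A column beyond [j] is then
   beyond [t], and its vertex lies in the split face, contrary to [xs]. *)
have fj_lt : f j < r.-1.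
  by rewrite ltn_neqAle f_r // andbT; apply/eqP => fj; rewrite fj in jv; lia.
have tj : t <= j by have := leq_mul fj_lt (leqnn t); lia.
case/negP: xs; apply/path_faceP; exists i.
rewrite xE (leq_ltn_trans tj ji) orbT; split=> //; congr young_vertex.
apply: young_face_rows => //; first by rewrite -FE.
by rewrite (leq_ltn_trans tj ji).
Qed.

Lemma young_not_split : 2 <= t -> t < part la 2 -> ~ (
  forall F G, F \in facets (young_complex la t) -> G \in facets (young_complex la t) ->
  young_split_face \subset F -> young_split_face \subset G ->
  forall x y, x \in F :\: young_split_face -> y \in G :\: young_split_face ->
  ((r.-1 * t).+1 < x) = ((r.-1 * t).+1 < y)).
Proof.
move=> t2 la2; have [r_gt1 tn] := two_rows la2.
have n_gt1 : 1 < n by apply: ltn_trans tn.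
have n_gt0 := ltnW n_gt1.
have r2t : r.-1 * t = r.-2 * t + t by rewrite -mulSnr; congr (_ * _); lia.
(* The two facets are the whole top row and the path [g], which takes the second row up to column
   [t], where its entry equals the first entry of the top row. *)
pose g i := if i <= t then r.-2 else r.-1.
have top_b : between n young_low young_top young_top.
  by split=> // i i_n; rewrite young_low_le /=.
have g_b : between n young_low young_top g.
  split=> [i i_n|i j /andP[ij _]]; last by rewrite /g; case: (leqP j t); case: (leqP i t); lia.
  have := young_low_le i_n; rewrite /g /young_top; case: (leqP i t) => [it|_]; last by lia.
  have [_ la_sorted _] := and3P hla.
  have : i < part la 2 by apply: leq_ltn_trans la2.
  by rewrite /part nth_sorted_count // /young_low; lia.
pose face f := path_face n young_vertex predT f.
have face_facet f : between n young_low young_top f -> face f \in facets (young_complex la t).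
  by move=> fb; rewrite facets_young_complex; apply/young_facets_family; exists f.
have top_s : young_split_face \subset face young_top.
  by apply/subsetP=> x /path_faceP[i [i_n _ ->]]; apply/path_faceP; exists i.
have g_s : young_split_face \subset face g.
  apply/subsetP=> x /path_faceP[i [i_n /orP[/eqP->|ti] ->]]; apply/path_faceP.
    exists t; split=> //; apply: val_inj; rewrite /g leqnn /= !young_vertexE //; last by lia.
    by rewrite /young_top r2t; lia.
  by exists i; split=> //; rewrite /g leqNgt ti.
move=> /(_ _ _ (face_facet _ top_b) (face_facet _ g_b) top_s g_s).
move=> /(_ (young_vertex 1 r.-1) (young_vertex 0 r.-2)).
rewrite !young_vertexE //; last by lia.
rewrite (_ : (_ < _) = true) 1?(_ : (_ < _ + 1) = false); try by lia.
have in_D i f : i < n -> young_vertex i (f i) \notin young_split_face ->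
    young_vertex i (f i) \in face f :\: young_split_face.
  by move=> i_n xs; rewrite in_setD xs; apply/path_faceP; exists i.
move=> split_eq; suff: true = false by []; apply: split_eq.
  apply: (in_D 1 young_top) => //; apply/path_faceP => -[i [i_n iS]].
  by move/(congr1 val); rewrite /= !young_vertexE /young_top //; lia.
apply: (in_D 0 g) => //; apply/path_faceP => -[i [i_n iS]].
by move/(congr1 val); rewrite /= !young_vertexE /g ?leq0n /young_top //; lia.
Qed.

End Young.

Theorem theorem0p3 (K : fieldType) (la : seq nat) (hla : is_partition la) :
  vertex_decomposable (young_complex la 1) /\
  (forall t : nat, 2 <= t ->
    [<-> vertex_decomposable (young_complex la t);
         shellable (young_complex la t);
         cohen_macaulay K (young_complex la t);
         size la = 1 \/ (2 <= size la /\ part la 2 <= t)]).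
Proof.
split; first exact: young_complex_vd_diagonal.
move=> t t2; have t_gt0 := ltnW t2.
have cD := young_complex_complex t hla.
have cardD : {in facets (young_complex la t), forall F : {set _}, #|F| = part la 1}.
  by move=> F; rewrite facets_young_complex => /card_young_facet.
(* For a single row [part la 2] is the default [0], so condition (4) is just [part la 2 <= t]. *)
have rows : part la 2 <= t -> size la = 1 \/ (2 <= size la /\ part la 2 <= t).
  by have [] := and3P hla; case: (size la) => [|[|k]] // _ _ _; [left | right].
have cols : size la = 1 \/ (2 <= size la /\ part la 2 <= t) -> part la 2 <= t.
  by case=> [la1|[]//]; rewrite /part nth_default ?la1.
have cols_vd : part la 2 <= t -> vertex_decomposable (young_complex la t).
  exact: young_complex_vd_columns.
tfae.
- move=> vdD; split=> [F G /cardD-> /cardD-> //|].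
  have [Fs [uFs Fs_mem exFs]] := vd_exchange_order vdD cD.
  by exists Fs; split=> //; apply: exchange_shelling.
(* Shellability yields the Cohen-Macaulay property through the bound on [la_2] and
   vertex-decomposability. *)
- move=> shD; apply: vd_cohen_macaulay (cols_vd _) cD cardD.
  rewrite leqNgt; apply/negP => la2; apply: (young_not_split hla t_gt0 t2 la2).
  exact: shellable_link_connected shD (young_link_split hla t_gt0 t2 la2).
- move=> cmD; apply: rows; rewrite leqNgt; apply/negP => la2.
  apply: (young_not_split hla t_gt0 t2 la2).
  exact: cm_link_connected cD cmD (young_link_split hla t_gt0 t2 la2).
by move/cols/cols_vd.
Qed.
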